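(* Every simple module of $\mathbb{T}_W^{\leq}$ (and hence of $\mathbb{T}_W$) is a highest weight module with respect to the Borel subalgebra $\mathfrak{b}(\prec)^{\min}$ of $\mathfrak{g}=W(\infty)$.
   Context: The ground field is $\mathbb{C}$; $I=\{1,2,3,\dots\}$. $\mathfrak{gl}(\infty)$ is the Lie algebra of matrices $(a_{ij})_{i,j\in I}$ with finitely many nonzero entries, with matrix units $E_{i,j}$. A $\mathfrak{gl}(\infty)$-module $M$ is integrable if $\dim\operatorname{Span}\{x^i m\mid i>0\}<\infty$ for all $x\in\mathfrak{gl}(\infty)$, $m\in M$. $\Lambda(\infty)$ is the Grassmann algebra on odd generators $\xi_i$ ($i\in I$), $\mathbb{Z}$-graded by $\deg\xi_i=1$; $\partial_i$ is the odd superderivation with $\partial_i(\xi_j)=\delta_{ij}$. $\mathfrak{g}=W(\infty)=\varinjlim W(n)$ (where $W(n)$ is the Lie superalgebra of superderivations of the Grassmann algebra $\Lambda(n)$) is the Lie superalgebra spanned by the superderivations $P\partial_j$ of $\Lambda(\infty)$, $P\in\Lambda(\infty)$, $j\in I$. It is $\mathbb{Z}$-graded, $\mathfrak{g}=\bigoplus_{k\ge-1}\mathfrak{g}^k$, with $\mathfrak{g}^k=\operatorname{Span}\{P\partial_j\mid P\in\Lambda(\infty)^{k+1},\ j\in I\}$, and parity equal to degree mod $2$; $\mathfrak{g}^0$ is identified with $\mathfrak{gl}(\infty)$ via $\xi_i\partial_j\leftrightarrow E_{i,j}$. Put $\mathfrak{g}^{\leq}=\mathfrak{g}^{-1}\oplus\mathfrak{g}^0$,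 $\mathfrak{g}^{<}=\mathfrak{g}^{-1}$. For $n\ge1$, $\mathfrak{t}_n\subset\mathfrak{g}$ is the subalgebra generated by all $\partial_j$ and $\xi_{i_1}\cdots\xi_{i_k}\partial_j$ with $j,i_1,\dots,i_k\ge n$. $\mathbb{T}_W$ (resp. $\mathbb{T}_W^{\leq}$) is the full subcategory of $\mathfrak{g}$-modules $M$ such that: (1) $M$ has a $\mathbb{Z}$-grading $M=\bigoplus_{k\in\mathbb{Z}}M^k$ compatible with the superalgebra grading (i.e. $\mathfrak{g}^iM^j\subseteq M^{i+j}$ and the parity of $M^k$ is $k$ mod $2$); (2) $M$ is integrable over $\mathfrak{g}^0$; (3) for every $m\in M$ there is $n$ with $\mathfrak{t}_n\subseteq\operatorname{Ann}_{\mathfrak{g}}(m)$ (resp. $\mathfrak{t}_n\cap\mathfrak{g}^{\leq}\subseteq\operatorname{Ann}_{\mathfrak{g}}(m)$). Let $\mathfrak{h}=\operatorname{Span}\{E_{i,i}\}$ be the diagonal Cartan subalgebra and let $\prec$ be the linear order $1\prec3\prec5\prec\cdots\prec6\prec4\prec2$ on $I$. Put $\mathfrak{n}(\prec)^0=\operatorname{Span}\{E_{i,j}\mid i\prec j\}$, $\mathfrak{b}(\prec)^0=\mathfrak{h}\oplus\mathfrak{n}(\prec)^0$, and $\mathfrak{b}(\prec)^{\min}=\mathfrak{b}(\prec)^0\oplus\mathfrak{g}^{<}$. A $\mathfrak{g}$-module is a highest weight module with respect to $\mathfrak{b}(\prec)^{\min}$ if it is generated by a nonzero $\mathfrak{h}$-weight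 vector annihilated by $\mathfrak{n}(\prec)^0\oplus\mathfrak{g}^{<}$. *)

(* Defs.v *)
From HB Require Import structures.
From mathcomp Require Import all_boot all_order all_algebra.
From mathcomp Require Import finmap monalg ring.
From mathcomp Require Import boolp classical_sets functions.

Set Implicit Arguments.
Unset Strict Implicit.
Unset Printing Implicit Defensive.

Import GRing.Theory.
Local Open Scope classical_set_scope.
Local Open Scope ring_scope.

Definition index := {i : nat | (0 < i)%N}.

Section Linear.
Variables (K : fieldType) (V : lmodType K).

Definition is_subspace (S : set V) : Prop :=
  S 0 /\ forall (a : K) (u v : V), S u -> S v -> S (a *: u + v).

Definition span (X : set V) : set V := smallest is_subspace X.

Definition add_sets (A B : set V) : set V := [set x + y | x in A & y in B].

Definition finite_dimensional (X : set V) : Prop :=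
  exists s : seq V, X `<=` span [set` s].

(* [V] is the internal direct sum of the subspaces [G i]. *)
Definition is_grading (I : eqType) (G : I -> set V) : Prop :=
  [/\ forall i, is_subspace (G i),
      forall v, exists (s : seq I) (c : I -> V),
        (forall i, G i (c i)) /\ v = \sum_(i <- s) c i
    & forall (s : seq I) (c : I -> V), uniq s -> (forall i, G i (c i)) ->
        \sum_(i <- s) c i = 0 -> forall i, i \in s -> c i = 0].

Lemma subspace_span (X : set V) : is_subspace (span X).
Proof.
split=> [S [[]]//|a u v Xu Xv S SX].
by case: (SX) => -[_ S2] _; apply: S2; [apply: Xu|apply: Xv].
Qed.

Lemma sub_span (X : set V) : X `<=` span X.
Proof. by move=> v Xv S [_]; apply. Qed.

Lemma span_min (X S : set V) : is_subspace S -> X `<=` S -> span X `<=` S.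
Proof. by move=> Ssub XS v; apply. Qed.

Lemma subspaceD (S : set V) u v : is_subspace S -> S u -> S v -> S (u + v).
Proof. by move=> [_ h] Su Sv; rewrite -(scale1r u); apply: h. Qed.

Lemma subspaceZ (S : set V) a u : is_subspace S -> S u -> S (a *: u).
Proof. by move=> [h0 h] Su; rewrite -(addr0 (a *: u)); apply: h. Qed.

Lemma subspace_sum (S : set V) (I : Type) (r : seq I) (P : pred I) F :
  is_subspace S -> (forall i, P i -> S (F i)) -> S (\sum_(i <- r | P i) F i).
Proof.
move=> Ssub SF; elim/big_rec: _ => [|i x Pi Sx]; first by case: Ssub.
by apply: subspaceD => //; apply: SF.
Qed.

Lemma subspace_preim (f : V -> V) (S : set V) :
  linear f -> is_subspace S -> is_subspace [set v | S (f v)].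
Proof.
move=> lf [S0 SD]; split=> [|a u v Su Sv] /=; last by rewrite lf; apply: SD.
by have := lf (-1) 0 0; rewrite scaler0 addr0 scaleN1r addNr => ->.
Qed.

Lemma scaler_swap (a c : K) (x y z w : V) :
  c *: (a *: x + y) + (a *: z + w) = a *: (c *: x + z) + (c *: y + w).
Proof. by rewrite !scalerDr addrACA !scalerA (mulrC a). Qed.

Lemma scaler_swapB (a s : K) (x y z w : V) :
  (a *: x + y) - s *: (a *: z + w) = a *: (x - s *: z) + (y - s *: w).
Proof. by rewrite scalerBr scalerDr opprD addrACA !scalerA (mulrC a). Qed.

Lemma sum_scaler_swap (I : finType) (a : K) (F G : I -> V) :
  \sum_i (a *: F i + G i) = a *: (\sum_i F i) + \sum_i G i.
Proof. by rewrite scaler_sumr big_split. Qed.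

Lemma sum_bool_only (F : bool -> V) d :
  (forall p, p != d -> F p = 0) -> \sum_p F p = F d.
Proof. by move=> Fd; rewrite (bigD1 d) //= big1 ?addr0. Qed.

End Linear.

(* The Grassmann algebra, with basis [<< A >>] standing for the product of the
   generators indexed by the finite set [A], taken in increasing order. *)
Definition grassmann (K : fieldType) := {malg K[{fset index}]}.
HB.instance Definition _ (K : fieldType) := GRing.Lmodule.on (grassmann K).

(* Number of transpositions sorting the concatenation of [A] and [B]. *)
Definition inversions (A B : {fset index}) : nat :=
  (\sum_(a <- A) \sum_(b <- B) (val b < val a))%N.

Section Grassmann.
Variable K : fieldType.
Implicit Types (A B : {fset index}) (P Q : grassmann K).

Definition linext (V : lmodType K) (f : {fset index} -> V) P : V :=
  \sum_(A <- msupp P) P@_A *: f A.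

Definition gmonomial A : grassmann K := << A >>.

Definition gmul_monomial A B : grassmann K :=
  if [disjoint A & B]%fset then (-1) ^+ inversions A B *: gmonomial (A `|` B)%fset
  else 0.

Definition gmul P Q : grassmann K :=
  linext (fun A => linext (gmul_monomial A) Q) P.

(* The sign counts the generators of index below [j] that [d_j] has to cross. *)
Definition gderiv_monomial (j : index) A : grassmann K :=
  if j \in A then (-1) ^+ inversions [fset j]%fset A *: gmonomial (A `\ j)%fset
  else 0.

Definition gderiv (j : index) : grassmann K -> grassmann K :=
  linext (gderiv_monomial j).

Section LinextTheory.
Variables (V : lmodType K) (f : {fset index} -> V).

Lemma linextEw (D : {fset {fset index}}) P : (msupp P `<=` D)%fset ->
  linext f P = \sum_(A <- D) P@_A *: f A.
Proof.
move=> PD; rewrite /linext (big_fset_incl _ PD) // => A _ AP.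
by rewrite mcoeff_outdom // scale0r.
Qed.

Lemma linext_is_linear : linear (linext f).
Proof.
move=> a P Q; pose D := (msupp P `|` msupp Q)%fset.
have DP : (msupp P `<=` D)%fset by apply: fsubsetUl.
have DQ : (msupp Q `<=` D)%fset by apply: fsubsetUr.
have DS : (msupp (a *: P + Q) `<=` D)%fset.
  apply: fsubset_trans (msuppD_le _ _) _; apply: fsetSU; exact: msuppZ_le.
rewrite (linextEw DP) (linextEw DQ) (linextEw DS) scaler_sumr -big_split /=.
by apply: eq_bigr => A _; rewrite mcoeffD mcoeffZ scalerDl scalerA.
Qed.

HB.instance Definition _ :=
  GRing.isLinear.Build K (grassmann K) V *:%R (linext f) linext_is_linear.

Lemma linext_monomial A : linext f (gmonomial A) = f A.
Proof.
by rewrite /linext msuppU oner_eq0 big_seq_fset1 mcoeffUU scale1r.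
Qed.

End LinextTheory.

HB.instance Definition _ (j : index) := GRing.Linear.on (gderiv j).

Lemma gderivD j P Q : gderiv j (P + Q) = gderiv j P + gderiv j Q.
Proof. exact: linearD. Qed.

Lemma gderivZ j a P : gderiv j (a *: P) = a *: gderiv j P.
Proof. exact: linearZ. Qed.

Lemma gderiv0 j : gderiv j 0 = 0.
Proof. exact: linear0. Qed.

Lemma grassmann_decomp P : P = \sum_(A <- msupp P) P@_A *: gmonomial A.
Proof.
rewrite {1}(monalgE P); apply: eq_bigr => A _.
by apply/malgP => B; rewrite mcoeffZ !mcoeffU -mulr_natr.
Qed.

Lemma eq_grassmann (V : lmodType K) (f g : grassmann K -> V) :
  linear f -> linear g -> (forall A, f (gmonomial A) = g (gmonomial A)) ->
  forall P, f P = g P.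
Proof.
move=> lf lg fg P.
pose f' := HB.pack f (GRing.isLinear.Build K (grassmann K) V *:%R f lf) :
  {linear grassmann K -> V}.
pose g' := HB.pack g (GRing.isLinear.Build K (grassmann K) V *:%R g lg) :
  {linear grassmann K -> V}.
rewrite (grassmann_decomp P) -[f _]/(f' _) -[g _]/(g' _) !linear_sum.
by apply: eq_bigr => A _; rewrite !linearZ /=; rewrite fg.
Qed.

Lemma gmulDl : left_distributive gmul +%R.
Proof. by move=> P Q S; rewrite /gmul linearD. Qed.

Lemma gmulDr : right_distributive gmul +%R.
Proof.
move=> P Q S; rewrite /gmul /linext -big_split /=; apply: eq_bigr => A _.
by rewrite -!/(linext _ _) linearD scalerDr.
Qed.

Lemma gmulZl a P Q : a *: gmul P Q = gmul (a *: P) Q.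
Proof. by rewrite /gmul linearZ. Qed.

Lemma gmulZr a P Q : a *: gmul P Q = gmul P (a *: Q).
Proof.
rewrite /gmul /linext scaler_sumr; apply: eq_bigr => A _.
rewrite -!/(linext _ _) [X in _ = _ *: X](linearZ_LR (linext (gmul_monomial A))).
by rewrite /= !scalerA (mulrC a).
Qed.

Lemma gmulE A B : gmul (gmonomial A) (gmonomial B) = gmul_monomial A B.
Proof. by rewrite /gmul !linext_monomial. Qed.

Lemma gderivE j A : gderiv j (gmonomial A) = gderiv_monomial j A.
Proof. exact: linext_monomial. Qed.

Local Notation sg A B := ((-1) ^+ inversions A B : K).

Lemma inv0l A : inversions fset0 A = 0%N.
Proof. by rewrite /inversions big_seq_fset0. Qed.

Lemma inv0r A : inversions A fset0 = 0%N.
Proof. by rewrite /inversions big1 // => a _; rewrite big_seq_fset0. Qed.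

Lemma sum_fsetU (A B : {fset index}) (F : index -> nat) :
  [disjoint A & B]%fset ->
  (\sum_(a <- (A `|` B)%fset) F a = \sum_(a <- A) F a + \sum_(a <- B) F a)%N.
Proof.
move=> AB; rewrite -big_cat /=; apply: perm_big; apply: uniq_perm; first exact: fset_uniq.
  rewrite cat_uniq !fset_uniq andbT /=; apply/hasPn => x xB; apply/negP => xA.
  by move: (fdisjointP AB x xA); rewrite xB.
by move=> x; rewrite mem_cat inE.
Qed.

Lemma invUl A B C : [disjoint A & B]%fset ->
  inversions (A `|` B)%fset C = (inversions A C + inversions B C)%N.
Proof. by move=> AB; rewrite /inversions sum_fsetU. Qed.

Lemma invUr A B C : [disjoint A & B]%fset ->
  inversions C (A `|` B)%fset = (inversions C A + inversions C B)%N.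
Proof.
move=> AB; rewrite /inversions -big_split; apply: eq_bigr => c _ /=.
by rewrite sum_fsetU.
Qed.

Lemma sgDl i A B : i \in A -> sg A B = sg [fset i]%fset B * sg (A `\ i)%fset B.
Proof.
move=> iA; rewrite -exprD -invUl ?fsetD1K // fdisjoint1X !inE eqxx //.
Qed.

Lemma sgDr i A B : i \in A -> sg B A = sg B [fset i]%fset * sg B (A `\ i)%fset.
Proof.
move=> iA; rewrite -exprD -invUr ?fsetD1K // fdisjoint1X !inE eqxx //.
Qed.

Lemma sgK A B : sg A B * sg A B = 1.
Proof. by rewrite -expr2 sqrr_sign. Qed.

Lemma inv1C i A :
  (inversions [fset i]%fset A + inversions A [fset i]%fset + (i \in A) = #|` A|)%N.
Proof.
have -> : (i \in A : nat) = (\sum_(a <- A) (a == i))%N.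
  case: (boolP (i \in A)) => iA.
    rewrite (big_fsetD1 i) //= eqxx big_seq big1 ?addn0 // => a.
    by rewrite !inE => /andP[/negPf ->].
  rewrite big_seq big1 // => a aA; case: eqP => // ai.
  by rewrite -ai aA in iA.
rewrite /inversions big_seq_fset1 -!big_split /= -sum1_size.
apply: eq_bigr => a _; rewrite big_seq_fset1.
by rewrite -val_eqE; case: ltngtP.
Qed.

Lemma invC A B : [disjoint A & B]%fset ->
  (inversions A B + inversions B A = #|` A| * #|` B|)%N.
Proof.
move=> AB; have -> : inversions B A = (\sum_(a <- A) inversions B [fset a]%fset)%N.
  rewrite /inversions exchange_big; apply: eq_bigr => a _.
  by apply: eq_bigr => b _; rewrite big_seq_fset1.
have -> : inversions A B = (\sum_(a <- A) inversions [fset a]%fset B)%N.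
  by rewrite /inversions; apply: eq_bigr => a _; rewrite big_seq_fset1.
rewrite -big_split /= -sum1_size big_distrl /= !big_seq.
apply: eq_bigr => a aA; rewrite mul1n -(inv1C a B).
by rewrite (negPf (fdisjointP AB a aA)) addn0.
Qed.

Lemma inv11 i : inversions [fset i]%fset [fset i]%fset = 0%N.
Proof. by rewrite /inversions !big_seq_fset1 ltnn. Qed.

Lemma gone_neq0 : gmonomial fset0 != 0.
Proof. by rewrite /gmonomial monalgU_eq0 oner_eq0. Qed.

#[local] Opaque gmonomial inversions.

Lemma gmul0g P : gmul 0 P = 0.
Proof. by rewrite /gmul linear0. Qed.

Lemma gmulg0 P : gmul P 0 = 0.
Proof. by have := gmulZr 0 P 0; rewrite !scale0r. Qed.

Lemma gmul1g : left_id (gmonomial fset0) gmul.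
Proof.
apply: eq_grassmann => [a P Q|a P Q //|A].
  by rewrite gmulDr gmulZr.
by rewrite gmulE /gmul_monomial fdisjoint0X inv0l fset0U expr0 scale1r.
Qed.

Lemma gmulg1 : right_id (gmonomial fset0) gmul.
Proof.
apply: eq_grassmann => [a P Q|a P Q //|A].
  by rewrite gmulDl gmulZl.
by rewrite gmulE /gmul_monomial fdisjointX0 inv0r fsetU0 expr0 scale1r.
Qed.

Lemma gmulA_monomial A B C :
  gmul (gmonomial A) (gmul (gmonomial B) (gmonomial C)) =
  gmul (gmul (gmonomial A) (gmonomial B)) (gmonomial C).
Proof.
rewrite !gmulE /gmul_monomial.
case: (boolP [disjoint B & C]%fset) => BC;
  case: (boolP [disjoint A & B]%fset) => AB.
- rewrite -gmulZr -gmulZl !gmulE /gmul_monomial fdisjointXU fdisjointUX AB BC.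
  rewrite andbT /=; case: (boolP [disjoint A & C]%fset) => AC.
    rewrite [LHS]scalerA [RHS]scalerA.
    rewrite -[X in X *: _ = _]exprD.
    rewrite -[X in _ = X *: _]exprD.
    rewrite (invUl _ AB) (invUr _ BC) fsetUA; congr (_ ^+ _ *: _).
    by rewrite addnC addnA.
  by rewrite !scaler0.
- rewrite -gmulZr gmul0g gmulE /gmul_monomial fdisjointXU (negPf AB).
  by rewrite scaler0.
- rewrite -gmulZl gmulg0 gmulE /gmul_monomial fdisjointUX (negPf BC) andbF.
  by rewrite scaler0.
- by rewrite gmulg0 gmul0g.
Qed.

Lemma gmulA : associative gmul.
Proof.
move=> P Q S; move: P; apply: eq_grassmann => [a P P'|a P P'|A].
- by rewrite gmulDl -gmulZl.
- by rewrite !gmulDl -!gmulZl.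
move: Q; apply: eq_grassmann => [a P P'|a P P'|B].
- by rewrite gmulDl gmulDr -gmulZl -gmulZr.
- by rewrite gmulDr gmulDl -gmulZr -gmulZl.
move: S; apply: eq_grassmann => [a P P'|a P P'|C].
- by rewrite !gmulDr -!gmulZr.
- by rewrite gmulDr -gmulZr.
exact: gmulA_monomial.
Qed.

HB.instance Definition _ := GRing.Zmodule_isNzRing.Build (grassmann K)
  gmulA gmul1g gmulg1 gmulDl gmulDr gone_neq0.
HB.instance Definition _ :=
  GRing.Lmodule_isLalgebra.Build K (grassmann K) gmulZl.
HB.instance Definition _ :=
  GRing.Lalgebra_isAlgebra.Build K (grassmann K) gmulZr.

Definition xi (i : index) : grassmann K := gmonomial [fset i]%fset.


Lemma gmul_mulE P Q : P * Q = gmul P Q. Proof. by []. Qed.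

Lemma gmulC_monomial A B : gmonomial A * gmonomial B =
  (-1) ^+ (#|` A| * #|` B|) *: (gmonomial B * gmonomial A).
Proof.
rewrite !gmul_mulE !gmulE /gmul_monomial fdisjoint_sym.
case: (boolP [disjoint B & A]%fset) => BA; last by rewrite scaler0.
have AB : [disjoint A & B]%fset by rewrite fdisjoint_sym.
rewrite [RHS]scalerA fsetUC -(invC AB) exprD -mulrA sgK mulr1.
by [].
Qed.

Lemma gderiv_xi i j : gderiv i (xi j) = (i == j)%:R.
Proof.
rewrite gderivE /gderiv_monomial in_fset1; case: eqP => [->|//].
by rewrite fsetDv inv11 expr0 scale1r.
Qed.

Lemma sgC j A : sg [fset j]%fset A * sg A [fset j]%fset = (-1) ^+ (#|` A| - (j \in A)).
Proof. by rewrite -exprD -(inv1C j A) addnK. Qed.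

Lemma gderivM_monomial j A B :
  gderiv j (gmonomial A * gmonomial B) = gderiv j (gmonomial A) * gmonomial B
    + (-1) ^+ #|` A| *: (gmonomial A * gderiv j (gmonomial B)).
Proof.
rewrite !gmul_mulE gmulE !gderivE /gmul_monomial.
have disjD1 (X Y : {fset index}) i : [disjoint X & Y]%fset -> [disjoint X & Y `\ i]%fset.
  by move=> XY; apply: fdisjointWr XY; apply: fsubD1set.
case: (boolP [disjoint A & B]%fset) => AB.
  rewrite gderivZ gderivE /gderiv_monomial in_fsetU.
  case: (boolP (j \in A)) => jA.
    have jB := fdisjointP AB j jA.
    have AB' : [disjoint A `\ j & B]%fset.
      by rewrite fdisjoint_sym; apply: disjD1; rewrite fdisjoint_sym.
    rewrite (negPf jB) gmulg0 scaler0 addr0 -gmulZl gmulE /gmul_monomial AB'.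
    have -> : ((A `|` B) `\ j = A `\ j `|` B)%fset.
      by rewrite fsetDUl (mem_fsetD1 jB).
    rewrite [LHS]scalerA [RHS]scalerA; congr (_ *: _).
    rewrite (invUr _ AB) exprD (sgDl B jA); have := sgK [fset j]%fset B.
    move: (sg _ _) (sg _ _) (sg _ _) => a b c h; ring: h.
  case: (boolP (j \in B)) => jB; last by rewrite gmulg0 gmul0g !scaler0 addr0.
  rewrite gmul0g add0r -gmulZr gmulE /gmul_monomial (disjD1 _ _ j AB).
  have -> : ((A `|` B) `\ j = A `|` B `\ j)%fset.
    by rewrite fsetDUl (mem_fsetD1 jA).
  rewrite ![LHS]scalerA ![RHS]scalerA; congr (_ *: _).
  rewrite (invUr _ AB) exprD (sgDr A jB).
  have := sgC j A; rewrite (negPf jA) subn0 => <-.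
  have := sgK A [fset j]%fset.
  move: (sg _ _) (sg _ _) (sg _ _) (sg _ _) => a b c d h; ring: h.
rewrite gderiv0 /gderiv_monomial.
have disjD1' (X Y : {fset index}) : j \notin X ->
    [disjoint X & Y `\ j]%fset -> [disjoint X & Y]%fset.
  move=> jX XY; apply/fdisjointP => x xX; move: (fdisjointP XY x xX).
  rewrite in_fsetD1 negb_and negbK => /orP[/eqP xj|//].
  by rewrite xj (negPf jX) in xX.
case: (boolP (j \in A)) => jA; last first.
  rewrite gmul0g add0r; case: (boolP (j \in B)) => jB; last by rewrite gmulg0 scaler0.
  rewrite -gmulZr gmulE /gmul_monomial ifF ?scaler0 //.
  by apply: contraNF AB; apply: disjD1'.
case: (boolP (j \in B)) => jB; last first.
  rewrite gmulg0 scaler0 addr0 -gmulZl gmulE /gmul_monomial ifF ?scaler0 //.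
  by apply: contraNF AB; rewrite fdisjoint_sym => /(disjD1' _ _ jB); rewrite fdisjoint_sym.
rewrite -gmulZl -gmulZr !gmulE /gmul_monomial.
have -> : [disjoint A `\ j & B]%fset = [disjoint A & B `\ j]%fset.
  by rewrite -!fsetI_eq0 fsetIDAC fsetIDA.
case: (boolP [disjoint A & B `\ j]%fset) => _; last by rewrite !scaler0 addr0.
have -> : (A `\ j `|` B = A `|` B `\ j)%fset.
  by apply/fsetP => x; rewrite !inE; case: eqP => [->|_]; rewrite ?jA ?jB.
rewrite !scalerA -scalerDl.
rewrite [X in X *: _](_ : _ = 0) ?scale0r //.
have := sgC j A; rewrite jA => h.
have cA : (#|` A| = (#|` A| - true).+1)%N by rewrite (cardfsD1 j A) jA addKn.
rewrite cA exprS -h.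
rewrite (sgDr (A `\ j)%fset jB) (sgDl (B `\ j)%fset jA).
rewrite (sgDr [fset j]%fset jB) inv11 expr0 mul1r.
rewrite (sgDl [fset j]%fset jA) inv11 expr0 mul1r.
have := sgK [fset j]%fset (B `\ j)%fset.
move: (sg _ _) (sg _ _) (sg _ _) (sg _ _) => a b c d h1; ring: h1.
Qed.

Lemma gderivC_monomial i j A :
  gderiv i (gderiv j (gmonomial A)) = - gderiv j (gderiv i (gmonomial A)).
Proof.
rewrite !gderivE /gderiv_monomial.
have ss a b (B : {fset index}) : a \in B -> b \in B -> a != b ->
  gderiv b ((-1) ^+ inversions [fset a]%fset B *: gmonomial (B `\ a)%fset)
  = (sg [fset a]%fset B * sg [fset b]%fset B * sg [fset b]%fset [fset a]%fset)
    *: gmonomial (B `\ a `\ b)%fset.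
  move=> aB bB ab; rewrite gderivZ gderivE /gderiv_monomial in_fsetD1 bB eq_sym ab.
  rewrite [LHS]scalerA; congr (_ *: _).
  rewrite [X in _ = _ * X * _](sgDr [fset b]%fset aB).
  have := sgK [fset b]%fset [fset a]%fset.
  move: (sg _ _) (sg _ _) (sg _ _) => x y z h; ring: h.
case: (boolP (j \in A)) => jA; case: (boolP (i \in A)) => iA; last first.
- by rewrite !gderiv0 oppr0.
- rewrite gderivZ gderivE /gderiv_monomial in_fsetD1 (negPf jA) andbF.
  by rewrite scaler0 gderiv0 oppr0.
- rewrite gderivZ gderivE /gderiv_monomial in_fsetD1 (negPf iA) andbF.
  by rewrite scaler0 gderiv0 oppr0.
case: (eqVneq i j) => [<-|ij].
  rewrite gderivZ gderivE /gderiv_monomial in_fsetD1 eqxx.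
  by rewrite scaler0 oppr0.
rewrite ss // 1?eq_sym // ss // -[RHS]scaleNr fsetDDl fsetUC -fsetDDl.
congr (_ *: _).
have := sgC i [fset j]%fset; rewrite in_fset1 (negPf ij) cardfs1 subn0 expr1.
have := sgK [fset i]%fset [fset j]%fset.
have ds (z t : K) : z * z = 1 -> z * t = -1 -> t = - z.
  by move=> h1 h2; rewrite -[t]mul1r -h1 -mulrA h2 mulrN1.
move=> h1 h2; rewrite (ds _ _ h1 h2).
move: (sg _ _) (sg _ _) (sg _ _) => x y z; ring.
Qed.

Lemma gderivC i j P : gderiv i (gderiv j P) = - gderiv j (gderiv i P).
Proof.
move: P; apply: eq_grassmann => [a P Q|a P Q|A]; last exact: gderivC_monomial.
- by rewrite !(gderivD, gderivZ).
- by rewrite !(gderivD, gderivZ) opprD scalerN.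
Qed.

(* The projection of the Grassmann algebra onto its part of parity [p]. *)
Definition gparity (p : bool) : grassmann K -> grassmann K :=
  linext (fun A => if odd #|` A| == p then gmonomial A else 0).

HB.instance Definition _ (p : bool) := GRing.Linear.on (gparity p).

Definition ghomogeneous (d : int) : set (grassmann K) :=
  [set P | forall A, A \in msupp P -> (#|` A|)%:Z = d].

Lemma gderivM_monomial_left j A P :
  gderiv j (gmonomial A * P) = gderiv j (gmonomial A) * P
    + (-1) ^+ #|` A| *: (gmonomial A * gderiv j P).
Proof.
move: P; apply: eq_grassmann => [a P Q|a P Q|B]; last exact: gderivM_monomial.
- by rewrite mulrDr -scalerAr gderivD gderivZ.
have aux (s : K) (u1 u2 v1 v2 : grassmann K) :
    (a *: u1 + u2) + s *: (a *: v1 + v2) = a *: (u1 + s *: v1) + (u2 + s *: v2).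
  by rewrite !scalerDr addrACA !scalerA (mulrC a).
by rewrite gderivD gderivZ !mulrDr -!scalerAr aux.
Qed.

Local Notation operator := (grassmann K -> grassmann K).

(* The component of parity [p] of a linear operator. *)
Definition op_parity (p : bool) (D : operator) : operator :=
  fun P => \sum_(q : bool) gparity (p (+) q) (D (gparity q P)).

(* The bilinear extension of [D, E] = D E - (-1)^(|D||E|) E D. *)
Definition op_bracket (D E : operator) : operator :=
  fun P => \sum_(p : bool) \sum_(q : bool)
    (op_parity p D (op_parity q E P)
     - (-1) ^+ (p && q) *: op_parity q E (op_parity p D P)).

Definition op_vect (P : grassmann K) (j : index) : operator :=
  fun Q => P * gderiv j Q.

Definition op_W : set operator := span [set D | exists P j, D = op_vect P j].

Lemma op_addE a (D E : operator) P : (a *: D + E) P = a *: D P + E P.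
Proof. by []. Qed.

Lemma op_0E P : (0 : operator) P = 0.
Proof. by []. Qed.

Lemma op_vect_linear P j : linear (op_vect P j).
Proof.
by move=> a Q S; rewrite /op_vect gderivD gderivZ mulrDr -scalerAr.
Qed.

Lemma subspace_linear : is_subspace [set D : operator | linear D].
Proof.
split=> [a P Q|c D E lD lE a P Q] /=.
  by rewrite !op_0E scaler0 addr0.
rewrite (op_addE c D E (a *: P + Q)) (op_addE c D E P) (op_addE c D E Q).
by rewrite lD lE scaler_swap.
Qed.

Lemma op_W_linear D : op_W D -> linear D.
Proof.
move: D; apply: (span_min subspace_linear) => _ [P [j ->]].
exact: op_vect_linear.
Qed.

Lemma op_W_monomial :
  op_W `<=` span [set D | exists A j, D = op_vect (gmonomial A) j].
Proof.
apply: span_min; first exact: subspace_span.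
move=> _ [P [j ->]]; set S := span _.
have -> : op_vect P j = \sum_(A <- msupp P) P@_A *: op_vect (gmonomial A) j.
  apply/funext => Q; rewrite {1}/op_vect {1}(grassmann_decomp P) mulr_suml fct_sumE.
  by apply: eq_bigr => A _; rewrite -scalerAl.
apply: subspace_sum => [|A _]; first exact: subspace_span.
apply: (@subspaceZ _ _ S); first exact: subspace_span.
by move=> T [_ XT]; apply: XT; exists A, j.
Qed.

Lemma gparityD p P Q : gparity p (P + Q) = gparity p P + gparity p Q.
Proof. exact: linearD. Qed.

Lemma gparityZ p a P : gparity p (a *: P) = a *: gparity p P.
Proof. exact: linearZ. Qed.

Lemma gparity0 p : gparity p 0 = 0.
Proof. exact: linear0. Qed.

Lemma gparityE p A :
  gparity p (gmonomial A) = if odd #|` A| == p then gmonomial A else 0.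
Proof. exact: linext_monomial. Qed.

Lemma op_parity_linear p D : linear D -> linear (op_parity p D).
Proof.
move=> lD a P Q; rewrite /op_parity -sum_scaler_swap.
by apply: eq_bigr => q _; rewrite gparityD gparityZ lD gparityD gparityZ.
Qed.

Lemma op_parityP p a (D E : operator) P :
  op_parity p (a *: D + E) P = a *: op_parity p D P + op_parity p E P.
Proof.
rewrite /op_parity -sum_scaler_swap; apply: eq_bigr => q _.
by rewrite (op_addE a D E) gparityD gparityZ.
Qed.

Lemma op_bracketPl E a (D D' : operator) : linear E ->
  op_bracket (a *: D + D') E = a *: op_bracket D E + op_bracket D' E.
Proof.
move=> lE; apply/funext => P.
rewrite [RHS]op_addE /op_bracket.
rewrite -sum_scaler_swap; apply: eq_bigr => p _.
rewrite -sum_scaler_swap; apply: eq_bigr => q _.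
rewrite !op_parityP (op_parity_linear q lE).
exact: scaler_swapB.
Qed.

Lemma op_bracketPr D a (E E' : operator) : linear D ->
  op_bracket D (a *: E + E') = a *: op_bracket D E + op_bracket D E'.
Proof.
move=> lD; apply/funext => P.
rewrite [RHS]op_addE /op_bracket.
rewrite -sum_scaler_swap; apply: eq_bigr => p _.
rewrite -sum_scaler_swap; apply: eq_bigr => q _.
rewrite !op_parityP (op_parity_linear p lD).
exact: scaler_swapB.
Qed.

Definition op_pure (d : bool) (D : operator) : Prop :=
  linear D /\ forall p, op_parity p D = if p == d then D else 0.

Lemma op_bracket_pure d e D E P : op_pure d D -> op_pure e E ->
  op_bracket D E P = D (E P) - (-1) ^+ (d && e) *: E (D P).
Proof.
move=> [lD hD] [lE hE]; rewrite /op_bracket.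
have F0 (F : operator) : linear F -> F 0 = 0.
  by move=> lF; have := lF (-1) 0 0; rewrite scaler0 addr0 scaleN1r addNr.
have [D0 E0] := (F0 D lD, F0 E lE).
rewrite (sum_bool_only (d := d)) => [|p /negPf pd].
  rewrite (sum_bool_only (d := e)) => [|q /negPf qe].
    by rewrite hD hE !eqxx.
  by rewrite hD hE eqxx qe D0 scaler0 subr0.
rewrite big1 // => q _; rewrite hD hE pd.
by case: eqP => _; rewrite ?E0 scaler0 subr0.
Qed.

Lemma gparity_mul p A B : gparity p (gmonomial A * gmonomial B) =
  if odd #|` A| (+) odd #|` B| == p then gmonomial A * gmonomial B else 0.
Proof.
rewrite gmul_mulE gmulE /gmul_monomial.
case: (boolP [disjoint A & B]%fset) => AB; last by rewrite gparity0 if_same.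
rewrite gparityZ gparityE cardfsU.
have -> : (A `&` B)%fset = fset0 by apply/eqP; rewrite fsetI_eq0.
by rewrite cardfs0 subn0 oddD; case: ifP; rewrite ?scaler0.
Qed.

Lemma op_vect_pure A j : op_pure (~~ odd #|` A|) (op_vect (gmonomial A) j).
Proof.
split=> [|p]; first exact: op_vect_linear.
apply/funext; apply: eq_grassmann => [||B].
- exact/op_parity_linear/op_vect_linear.
- by case: eqP => _; [exact: op_vect_linear|case: subspace_linear].
have hB : gparity (p (+) odd #|` B|) (op_vect (gmonomial A) j (gmonomial B)) =
    if p == ~~ odd #|` A| then op_vect (gmonomial A) j (gmonomial B) else 0.
  rewrite /op_vect gderivE /gderiv_monomial.
  case: (boolP (j \in B)) => jB; last by rewrite mulr0 gparity0 if_same.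
  rewrite -scalerAr gparityZ gparity_mul (cardfsD1 j B) jB /=.
  by case: (odd _) (odd _) p => [] [] []; rewrite /= ?scaler0.
rewrite /op_parity (bigD1 (odd #|` B|)) //= big1 ?addr0.
  by rewrite gparityE eqxx hB; case: eqP.
move=> q qB; rewrite gparityE eq_sym (negPf qB).
by rewrite /op_vect gderiv0 mulr0 gparity0.
Qed.

Lemma cancel_second_order (G : algType K) (a b da db x y z t : G) (s eA eB : K) :
  eB *: (a * b * z) = (s * eA) *: (b * a * t) ->
  a * (db * x + eB *: (b * z)) - s *: (b * (da * y + eA *: (a * t))) =
  (a * db) * x - s *: ((b * da) * y).
Proof.
move=> h; rewrite !mulrDr -!scalerAr !mulrA h.
by rewrite scalerDr scalerA opprD addrACA subrr addr0.
Qed.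

Lemma op_bracket_vect A B i j :
  op_bracket (op_vect (gmonomial A) i) (op_vect (gmonomial B) j) =
  op_vect (gmonomial A * gderiv i (gmonomial B)) j
  - (-1) ^+ (~~ odd #|` A| && ~~ odd #|` B|) *:
    op_vect (gmonomial B * gderiv j (gmonomial A)) i.
Proof.
apply/funext => P.
rewrite (op_bracket_pure P (op_vect_pure A i) (op_vect_pure B j)).
set s := (-1) ^+ _.
rewrite /op_vect !gderivM_monomial_left.
apply: cancel_second_order.
rewrite (gderivC i j) (gmulC_monomial B A) mulrN scalerN -scalerAl.
rewrite [X in _ = X]scalerA -scaleNr.
congr (_ *: _); rewrite /s -(signr_odd _ #|` A|) -(signr_odd _ #|` B|).
rewrite -(signr_odd _ (#|` B| * #|` A|)) oddM.
by case: (odd _) (odd _) => [] []; rewrite /= ?expr0 ?expr1; ring.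
Qed.

Lemma op_W_vect P j : op_W (op_vect P j).
Proof. by move=> S [_]; apply; exists P, j. Qed.

Lemma op_W_bracket D E : op_W D -> op_W E -> op_W (op_bracket D E).
Proof.
move=> WD WE; have sW := subspace_span [set D | exists P j, D = op_vect P j].
have lE := op_W_linear WE; move: (D) (op_W_monomial WD).
apply: (@span_min _ _ _ [set D | op_W (op_bracket D E)]) => /=.
  apply: (@subspace_preim _ _ (op_bracket^~ E)) => // a F G.
  exact: op_bracketPl.
move=> _ [A [i ->]]; move: (E) (op_W_monomial WE).
apply: (@span_min _ _ _ [set F | op_W (op_bracket (op_vect (gmonomial A) i) F)]).
  apply: (@subspace_preim _ _ (op_bracket (op_vect (gmonomial A) i))) => // a F G.
  by apply: op_bracketPr; apply: op_vect_linear.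
move=> _ [B [j ->]].
change (op_W (op_bracket (op_vect (gmonomial A) i) (op_vect (gmonomial B) j))).
rewrite op_bracket_vect -scaleNr.
apply: (subspaceD sW); first exact: op_W_vect.
apply: (subspaceZ _ sW); exact: op_W_vect.
Qed.

End Grassmann.

(* W(oo), the span of the superderivations [P d_j] inside the linear operators
   on the Grassmann algebra. *)
Section Winfty.
Variable K : fieldType.

Definition Winfty_pred : {pred grassmann K -> grassmann K} :=
  fun D => `[< op_W D >].

Fact Winfty_submod_closed : submod_closed Winfty_pred.
Proof.
have [W0 WD] := subspace_span [set D | exists P j, D = @op_vect K P j].
split=> [|a D E /asboolP hD /asboolP hE]; apply/asboolP => //.
exact: WD.
Qed.

HB.instance Definition _ := GRing.isSubmodClosed.Build K
  (grassmann K -> grassmann K) Winfty_pred Winfty_submod_closed.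

Record Winfty := MkWinfty {
  Wop :> grassmann K -> grassmann K;
  Wop_in : Wop \in Winfty_pred
}.

HB.instance Definition _ := [isSub for Wop].
HB.instance Definition _ := [Choice of Winfty by <:].
HB.instance Definition _ := [SubChoice_isSubLmodule of Winfty by <:].

Lemma op_W_Wop (x : Winfty) : op_W (Wop x).
Proof. by apply/asboolP; apply: Wop_in. Qed.

Definition to_Winfty (D : grassmann K -> grassmann K) (h : op_W D) : Winfty :=
  MkWinfty (asboolT h : D \in Winfty_pred).

Definition bracket (x y : Winfty) : Winfty :=
  to_Winfty (op_W_bracket (op_W_Wop x) (op_W_Wop y)).

Definition vect (P : grassmann K) (j : index) : Winfty :=
  to_Winfty (op_W_vect P j).

Definition Wdeg (k : int) : set Winfty :=
  span [set x | exists P j, ghomogeneous (k + 1) P /\ x = vect P j].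

Definition Wparity (p : bool) : set Winfty :=
  span [set x | exists k : int, odd `|k|%N = p /\ Wdeg k x].

Lemma bracket_homogeneous p q x y P : Wparity p x -> Wparity q y ->
  bracket x y P = x (y P) - (-1) ^+ (p && q) *: y (x P).
Proof.
suff pure r z : Wparity r z -> op_pure r z.
  by move=> /pure hx /pure hy; rewrite -(op_bracket_pure P hx hy).
have sub (s : bool) : is_subspace [set u : Winfty | op_pure s u].
  have [l0 lD] := @subspace_linear K.
  have hp a (u v : grassmann K -> grassmann K) t :
      op_parity t (a *: u + v) = a *: op_parity t u + op_parity t v.
    by apply/funext => Q; rewrite op_parityP.
  have h0 t : op_parity t (0 : grassmann K -> grassmann K) = 0.
    have := hp (-1) 0 0 t; rewrite scaler0 addr0 => ->.
    by rewrite scaleN1r addNr.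
  split=> [|a u v [lu hu] [lv hv]] /=.
    by split=> // t; rewrite h0 if_same.
  split=> [|t]; first exact: lD.
  by rewrite hp hu hv; case: eqP => _; rewrite ?scaler0 ?addr0.
move: z; apply: (span_min (sub r)) => z [k [kr]].
move: z; apply: (span_min (sub r)) => _ [Q [j [hQ ->]]].
have -> : vect Q j = \sum_(A <- msupp Q) Q@_A *: vect (gmonomial K A) j.
  apply: val_inj; rewrite raddf_sum /=; apply/funext => S.
  rewrite fct_sumE {1}/op_vect {1}(grassmann_decomp Q) mulr_suml.
  by apply: eq_bigr => A _; rewrite -scalerAl.
rewrite big_seq; apply: (subspace_sum _ (sub r)) => A AQ.
apply: (subspaceZ _ (sub r)) => /=.
suff -> : r = ~~ odd #|` A| by apply: op_vect_pure.
have kA : k = #|` A|%:Z - 1 by rewrite (hQ A AQ) addrK.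
rewrite -kr kA; case: #|` A| => [//|n].
by rewrite -addn1 PoszD addrK addn1 /= negbK.
Qed.

Definition partial (j : index) : Winfty := vect 1 j.

Definition Eunit (i j : index) : Winfty := vect (xi K i) j.

Definition Wneg : set Winfty := Wdeg (-1).

Definition Wle : set Winfty := add_sets (Wdeg (-1)) (Wdeg 0).

Definition is_subalgebra (S : set Winfty) : Prop :=
  is_subspace S /\ forall x y, S x -> S y -> S (bracket x y).

(* The empty product is allowed in the second family; it gives [d_j] again. *)
Definition tail_algebra (n : index) : set Winfty :=
  smallest is_subalgebra
    ([set x | exists j, (val n <= val j)%N /\ x = partial j] `|`
     [set x | exists (s : seq index) j,
        [/\ all (fun i => (val n <= val i)%N) s, (val n <= val j)%N
          & x = vect (\prod_(i <- s) xi K i) j]]).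

Definition cartan : set Winfty := span [set x | exists i, x = Eunit i i].

Definition nil0 (r : rel index) : set Winfty :=
  span [set x | exists i j, r i j /\ x = Eunit i j].

(* The annihilator of a highest weight vector: n(r)^0 + g^<, the complement of
   the Cartan subalgebra in the Borel subalgebra b(r)^min. *)
Definition nil_min (r : rel index) : set Winfty := add_sets (nil0 r) Wneg.

End Winfty.

(* 1 < 3 < 5 < ... < 6 < 4 < 2 *)
Definition prec (i j : index) : bool :=
  if odd (val i) then ~~ odd (val j) || (val i < val j)%N
  else ~~ odd (val j) && (val j < val i)%N.

Record supermodule (K : fieldType) (M : lmodType K) := Supermodule {
  mparity : bool -> set M;
  mparity_grading : is_grading mparity;
  act : Winfty K -> M -> M;
  act_linearl : forall m, linear (act^~ m);
  act_linearr : forall x, linear (act x);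
  act_parity : forall p q x m,
    Wparity p x -> mparity q m -> mparity (p (+) q) (act x m);
  act_bracket : forall p q x y m, Wparity p x -> Wparity q y ->
    act (bracket x y) m =
      act x (act y m) - (-1) ^+ (p && q) *: act y (act x m)
}.

Section Modules.
Variables (K : fieldType) (M : lmodType K) (rho : supermodule M).

Definition compatible_grading (G : int -> set M) : Prop :=
  [/\ is_grading G,
      forall (i j : int) x m, Wdeg i x -> G j m -> G (i + j) (act rho x m)
    & forall k : int, G k `<=` mparity rho (odd `|k|%N)].

Definition integrable : Prop :=
  forall x m, Wdeg 0 x ->
    finite_dimensional [set iter i (act rho x) m | i in [set i | (0 < i)%N]].

Definition locally_annihilated (t : index -> set (Winfty K)) : Prop :=
  forall m, exists n, forall x, t n x -> act rho x m = 0.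

Definition in_TW : Prop :=
  [/\ exists G, compatible_grading G, integrable
    & locally_annihilated (@tail_algebra K)].

Definition in_TW_le : Prop :=
  [/\ exists G, compatible_grading G, integrable
    & locally_annihilated (fun n => @tail_algebra K n `&` @Wle K)].

Definition is_submodule (S : set M) : Prop :=
  is_subspace S /\ forall x m, S m -> S (act rho x m).

(* Submodules of a module over a Lie superalgebra are Z/2-graded; this only
   weakens the assumption of simplicity. *)
Definition is_graded_submodule (S : set M) : Prop :=
  is_submodule S /\
  forall m0 m1, mparity rho false m0 -> mparity rho true m1 ->
    S (m0 + m1) -> S m0 /\ S m1.

Definition simple_module : Prop :=
  (exists m : M, m <> 0) /\
  forall S, is_graded_submodule S -> S = [set 0] \/ S = setT.

(* [lambda] matters only on the Cartan subalgebra, where it is automatically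
   linear as soon as [v] is nonzero. *)
Definition weight_vector (v : M) : Prop :=
  exists lambda : Winfty K -> K,
    forall h, cartan h -> act rho h v = lambda h *: v.

Definition highest_weight_module (r : rel index) : Prop :=
  exists v : M,
    [/\ v <> 0, weight_vector v, forall x, nil_min r x -> act rho x v = 0
      & smallest is_submodule [set v] = setT].

End Modules.

(* Main.v *)
From HB Require Import structures.
Require Import Defs.
From mathcomp Require Import all_boot all_order all_algebra.
From mathcomp Require Import reals complex.
From mathcomp Require Import finmap monalg zify.
From mathcomp Require Import boolp classical_sets functions.

(** The theorem is proved by exhibiting, in every nonzero module of the larger
    category, a parity-homogeneous highest weight vector; simplicity does the
    rest, because the submodule generated by a homogeneous vector is graded
    ([generated_submodule_graded]), hence everything.

    The partial derivatives anticommute and square to zero, and all but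
    finitely many of them kill a given vector.  So the finitely many others can
    be applied in turn, whenever the result is nonzero, to reach a nonzero
    vector killed by all of them ([singular_vector_exists]).  The space of such
    vectors is a gl(oo)-module, which is integrable and whose vectors are each
    killed by all E_ij with i, j large.  What remains is a statement about
    gl(oo) alone ([highest_weight_vector_exists]); its proof has three steps.

    First, the root vectors E_ij with i odd and j even commute with each other;
    they span the nilradical of a parabolic subalgebra with two infinite
    blocks.  For i fixed, E_ij with j large acts nilpotently on v, since the
    iterates are eigenvectors of E_jj with distinct eigenvalues inside a finite
    dimensional space.  Moving the column index by the E_jl that kill v
    polarizes this to: all products of k operators E_i* vanish on v
    ([row_products_nilpotent]).  A last nonzero product is killed by almost the
    whole row, and doing this for the finitely many relevant rows, then for the
    columns by duality, leaves a vector v killed by E_ij as soon as one index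
    is large.  Commutators through a distant index then show that the whole
    block kills v ([block_vanishing]).

    Second, once the block kills v, the other positive root vectors with a
    distant index kill v for free: E_ij = [E_ik, E_kj] with k distant and of the
    other parity ([prec_tail_vanishing]).  This is where the shape of the order,
    with its two ends 1, 3, 5, ... and ..., 6, 4, 2, is used.

    Third, only finitely many diagonal units and positive roots are left.
    Commuting locally finite operators over an algebraically closed field have
    a common eigenvector, and the remaining root vectors, nilpotent on weight
    vectors, are killed one after the other along a chain of ideals of the
    nilradical of the Borel subalgebra. *)

Set Implicit Arguments.
Unset Strict Implicit.
Unset Printing Implicit Defensive.

Import Order.TTheory GRing.Theory Num.Theory.
Local Open Scope ring_scope.
Local Open Scope classical_set_scope.

Local Notation span := Defs.span.
Local Notation index := Defs.index.

(** * Locally finite operators *)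

Section LocallyFinite.
Variables (K : fieldType) (M : lmodType K).
Implicit Types (f x : {linear M -> M}) (m v w : M).

Lemma span_seqP (s : seq M) v : span [set` s] v ->
  exists a : 'rV[K]_(size s), v = \sum_(j < size s) a 0 j *: s`_j.
Proof.
move: v; apply: span_min => [|v /= vs].
  split=> [|c u v [a ->] [b ->]].
    by exists 0; rewrite big1 // => j _; rewrite mxE scale0r.
  exists (c *: a + b); rewrite -sum_scaler_swap.
  by apply: eq_bigr => j _; rewrite !mxE scalerDl scalerA.
have vi : (seq.index v s < size s)%N by rewrite index_mem.
exists (delta_mx 0 (Ordinal vi)); rewrite (bigD1 (Ordinal vi)) //= big1.
  by rewrite mxE !eqxx scale1r nth_index ?addr0.
by move=> j /negPf jv; rewrite mxE jv andbF scale0r.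
Qed.

(** The bound N depends on the finite dimensional set only, so that one
    dependency is available for any family in it; the matrix of coordinates has
    more rows than columns, hence a nonzero left kernel. *)
Lemma finite_dimensional_dependent (X : set M) : finite_dimensional X ->
  exists N, forall w : nat -> M, (forall k, X (w k)) ->
    exists u : 'rV[K]_N, u != 0 /\ \sum_(k < N) u 0 k *: w k = 0.
Proof.
move=> [s Xs]; exists (size s).+1 => w Xw.
have [a aP] := choice (fun k => span_seqP (Xs _ (Xw k))).
pose A := \matrix_(k < (size s).+1) a k.
have [u /sub_kermxP uA u0] : exists2 u : 'rV_(size s).+1, (u <= kermx A)%MS & u != 0.
  apply/rowV0Pn; rewrite kermx_eq0 /row_free.
  by apply: contraTneq (rank_leq_col A) => ->; rewrite ltnn.
exists u; split=> //.
under eq_bigr => k _ do rewrite aP scaler_sumr.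
rewrite exchange_big big1 //= => j _.
under eq_bigr => k _ do rewrite scalerA.
rewrite -scaler_suml; move/rowP: uA => /(_ j); rewrite !mxE => uA.
have -> : \sum_k u 0 k * a k 0 j = 0; last by rewrite scale0r.
by apply: etrans uA; apply: eq_bigr => k _; rewrite !mxE.
Qed.

Lemma finite_dimensional_span (X Y : set M) :
  finite_dimensional X -> Y `<=` span X -> finite_dimensional Y.
Proof.
move=> [s Xs] YX; exists s => v /YX; move: v; apply: span_min => //.
exact: subspace_span.
Qed.

(** Applying f - mu_N to a vanishing sum removes its last term and multiplies
    the others by nonzero scalars. *)
Lemma eigenvectors_independent f (mu : nat -> K) (v : nat -> M) N :
  injective mu -> (forall k, f (v k) = mu k *: v k) ->
  \sum_(k < N) v k = 0 -> forall k, (k < N)%N -> v k = 0.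
Proof.
move=> mu_inj; elim: N v => // N IH v fv sv0.
have low k : (k < N)%N -> v k = 0.
  move=> kN; pose w k := (mu k - mu N) *: v k.
  have /eqP : w k = 0.
    apply: (IH w) => // [l|].
      by rewrite /w linearZ /= fv !scalerA mulrC.
    have : f (\sum_(k < N.+1) v k) - mu N *: \sum_(k < N.+1) v k = 0.
      by rewrite sv0 linear0 scaler0 subrr.
    rewrite linear_sum scaler_sumr -sumrB big_ord_recr /= fv subrr addr0.
    by apply: etrans; apply: eq_bigr => l _; rewrite fv -scalerBl.
  rewrite scaler_eq0 subr_eq0 (inj_eq mu_inj) => /orP[/eqP kN'|/eqP //].
  by move: kN; rewrite kN' ltnn.
move=> k; rewrite ltnS leq_eqVlt => /orP[/eqP ->|]; last exact: low.
by move: sv0; rewrite big_ord_recr /= big1 ?add0r // => l _; apply: low.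
Qed.

Definition iterates f m : set M :=
  [set iter p f m | p in [set p | (0 < p)%N]].

(** The iterates x^k m are eigenvectors of f with the distinct eigenvalues
    lambda + k c, so a finite dimensional space contains only finitely many
    nonzero ones. *)
Lemma shift_nilpotent f x (c lambda : K) m :
  (forall k, k.+1%:R * c != 0) ->
  (forall w, f (x w) = x (f w) + c *: x w) -> f m = lambda *: m ->
  finite_dimensional (iterates x m) -> exists k, iter k x m = 0.
Proof.
move=> c0 fx fm /finite_dimensional_dependent[N dep].
have fk k : f (iter k x m) = (lambda + k%:R * c) *: iter k x m.
  elim: k => [|k IH] /=; first by rewrite mul0r addr0.
  rewrite fx IH linearZ /= -scalerDl; congr (_ *: _).
  by rewrite -natr1 mulrDl mul1r addrA.
have [k|u [u0 su]] := dep (fun k => iter k.+1 x m); first by exists k.+1.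
have [k uk] : exists k, u 0 k != 0.
  apply/existsP; apply: contraR u0 => /existsPn u0.
  by apply/eqP/rowP => k; rewrite mxE; apply/eqP/negPn/u0.
(* The coefficients are extended by 0 beyond N to index them by nat. *)
pose v l := (if insub l is Some l then u 0 l else 0) *: iter l.+1 x m.
exists k.+1; apply/eqP.
suff /eqP : v k = 0 by rewrite /v valK scaler_eq0 (negPf uk).
apply: (@eigenvectors_independent f (fun l => lambda + l.+1%:R * c) _ N) => //.
- have inj a b : (a <= b)%N -> lambda + a.+1%:R * c = lambda + b.+1%:R * c -> a = b.
    move=> ab /addrI/eqP; rewrite eq_sym -subr_eq0 -mulrBl -natrB ?ltnS //.
    rewrite subSS; case E: (b - a)%N => [|d]; last by rewrite (negPf (c0 d)).
    by move=> _; apply/eqP; rewrite eqn_leq ab -subn_eq0 E.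
  move=> a b; case: (leqP a b) => [|/ltnW] h e; first exact: inj.
  by symmetry; apply: inj.
- by move=> l; rewrite /v linearZ /= -iterS fk !scalerA mulrC.
by apply: etrans su; apply: eq_bigr => l _; rewrite /v valK.
Qed.

(** Keep applying operators of the family as long as the result is nonzero:
    this stops after fewer than k steps, and what it stops at is killed by the
    family.  The set S carries along the properties already obtained. *)
Lemma last_nonzero_product (I : Type) (P : I -> Prop) (x : I -> M -> M)
    (S : set M) k m :
  (forall i w, P i -> S w -> S (x i w)) -> S m -> m <> 0 ->
  (forall s, List.Forall P s -> size s = k -> foldr x m s = 0) ->
  exists v, [/\ S v, v <> 0 & forall i, P i -> x i v = 0].
Proof.
move=> Sx; elim: k m => [|k IH] m Sm m0 nil.
  by case: m0; apply: (nil [::]).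
have [all0|/existsNP[i /not_implyP[Pi xi0]]] :=
  pselect (forall i, P i -> x i m = 0); first by exists m.
apply: (IH (x i m)) => // [|s Ps sk]; first exact: Sx.
rewrite -foldr_rcons; apply: nil; last by rewrite size_rcons sk.
by rewrite -cats1; apply/List.Forall_app; split => //; constructor.
Qed.

End LocallyFinite.

Section Eigenvector.
Variables (K : closedFieldType) (M : lmodType K).

(** Factor X - a out of the annihilating polynomial: either m is an eigenvector
    for a, or f m - a m is nonzero and annihilated by the quotient.  The sum runs
    up to a bound N of the size of p, to make the induction a plain one. *)
Lemma eigenvector_from_annihilating_poly (f : {linear M -> M}) (S : set M) N :
  (forall a w, S w -> S (f w - a *: w)) ->
  forall (p : {poly K}) m, p != 0 -> (size p <= N)%N -> S m -> m <> 0 ->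
    \sum_(k < N) p`_k *: iter k f m = 0 ->
  exists v, [/\ S v, v <> 0 & exists c, f v = c *: v].
Proof.
move=> Sf; elim: N => [|N IH] p m p0 pN Sm m0 pf.
  by move: p0; rewrite -size_poly_eq0 -leqn0 pN.
case: (eqVneq (size p) 1) => [/eqP/size_poly1P[c c0 pc]|/eqP/eqP/closed_rootP].
  move: pf; rewrite pc big_ord_recl big1 => [|k _]; last first.
    by rewrite coefC scale0r.
  rewrite coefC addr0 /= => /eqP; rewrite scaler_eq0 (negPf c0).
  by move/eqP.
move=> [a /factor_theorem[q pq]].
have [fa0|fa0] := pselect (f m - a *: m = 0).
  by exists m; split => //; exists a; apply/eqP; rewrite -subr_eq0; apply/eqP.
have q0 : q != 0 by apply: contra_neq p0 => q0; rewrite pq q0 mul0r.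
have qN : (size q <= N)%N.
  by move: pN; rewrite pq size_Mmonic ?monicXsubC // size_XsubC addn2.
apply: (IH q (f m - a *: m)) => //; first exact: Sf.
have iterB k : iter k f (f m - a *: m) = iter k.+1 f m - a *: iter k f m.
  by elim: k => //= k ->; rewrite linearB linearZ.
rewrite -[RHS]pf pq.
under eq_bigr => k _ do rewrite iterB scalerBr.
under [in RHS]eq_bigr => k _ do rewrite mulrBr coefB coefMX coefMC scalerBl.
rewrite !sumrB; congr (_ - _).
  by rewrite big_ord_recl /= scale0r add0r.
rewrite big_ord_recr /= (nth_default _ qN) mul0r scale0r addr0.
by apply: eq_bigr => k _; rewrite scalerA.
Qed.

(** Stability of S is asked under the f - a only, because the eigenvector is
    reached through them; thus S may express that a vector is an eigenvector of
    other operators with unspecified eigenvalues, which is not a linear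
    condition. *)
Lemma eigenvector_exists (f : {linear M -> M}) (S : set M) m :
  (forall a w, S w -> S (f w - a *: w)) -> S m -> m <> 0 ->
  finite_dimensional (iterates f m) ->
  exists v, [/\ S v, v <> 0 & exists c, f v = c *: v].
Proof.
move=> Sf Sm m0 /finite_dimensional_dependent[N dep].
(* The dependency is one among the iterates of f m, so f m has to be nonzero
   to start from it. *)
have [fm0|fm0] := pselect (f m = 0).
  by exists m; split=> //; exists 0; rewrite scale0r.
have [k|u [u0 su]] := dep (fun k => iter k.+1 f m); first by exists k.+1.
apply: (@eigenvector_from_annihilating_poly f S N Sf (rVpoly u) (f m)) => //.
- by apply: contra_neq u0 => /(congr1 (@poly_rV _ N)); rewrite rVpolyK linear0.
- exact: size_poly.
- by have := Sf 0 m Sm; rewrite scale0r subr0.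
by apply: etrans su; apply: eq_bigr => k _; rewrite coef_rVpoly_ord -iterSr.
Qed.

End Eigenvector.

(** * Integrable gl(oo)-modules and the odd-even block *)

(** The matrix units e i j acting on an integrable gl(oo)-module each of whose
    vectors is killed by all E_ij with i and j large. *)
Record tame_gl_action (K : fieldType) (M : lmodType K)
    (e : index -> index -> {linear M -> M}) : Prop := TameGlAction {
  gl_bracket : forall i j k l m,
    e i j (e k l m) =
      e k l (e i j m) + (j == k)%:R *: e i l m - (l == i)%:R *: e k j m;
  gl_locally_finite : forall i j m, finite_dimensional (iterates (e i j) m);
  gl_tail : forall m, exists n, forall i j : index,
    (n <= val i)%N -> (n <= val j)%N -> e i j m = 0
}.

Definition stable (K : fieldType) (M : lmodType K)
    (e : index -> index -> {linear M -> M}) (P : index -> index -> Prop)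
    (S : set M) : Prop :=
  forall i j w, P i j -> S w -> S (e i j w).

Section Blocks.
Variables (K : numFieldType) (M : lmodType K).
Implicit Types (e : index -> index -> {linear M -> M}) (S : set M) (m v w : M).
Implicit Types (A B : pred index).

Definition disjoint_preds A B := forall k, A k -> ~~ B k.

Definition unbounded A := forall n, exists i : index, A i /\ (n <= val i)%N.

(** The automorphism x |-> - x^T of gl(oo), which exchanges rows and columns:
    each statement on rows is used twice thanks to it. *)
Lemma tame_gl_dual e : tame_gl_action e ->
  tame_gl_action (fun i j => \- e j i : {linear M -> M}).
Proof.
move=> [br fin tail]; split=> [i j k l m|i j m|m] /=.
- by rewrite !linearN !opprK br (eq_sym l i) (eq_sym j k) /= addrAC.
- apply: finite_dimensional_span (fin j i m) _ => _ [p p0 <-].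
  have -> : iter p (\- e j i) m = (-1) ^+ p *: iter p (e j i) m.
    elim: p {p0} => [|p IH] /=; first by rewrite scale1r.
    by rewrite IH linearZ /= exprS mulN1r scaleNr.
  apply: (@subspaceZ _ _ (span (iterates (e j i) m)) _ _ (subspace_span _)).
  by move=> T [_]; apply; exists p.
have [n nP] := tail m; exists n => i j ni nj /=.
by rewrite nP ?oppr0.
Qed.

(** A power of E_{i j0} kills m.  Since E_{j0 j} kills m, commutes with the
    E_il for l in B distinct from j0, and [E_{j0 j}, E_{i j0}] = - E_ij,
    applying it to a vanishing product replaces one factor E_{i j0} by a
    multiple of E_ij.  The strict bound on the column indices keeps them
    distinct from j0. *)
Lemma row_products_nilpotent e A B i (j0 : index) m :
  tame_gl_action e -> disjoint_preds A B -> A i -> B j0 ->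
  (forall k l, B k -> B l -> (val j0 <= val k)%N -> (val j0 <= val l)%N ->
     e k l m = 0) ->
  exists k, forall s, List.Forall (fun j => B j /\ (val j0 < val j)%N) s ->
    size s = k -> foldr (e i) m s = 0.
Proof.
move=> [br fin tail] AB Ai Bj0 m0.
have neq j : B j -> (j == i) = false.
  by move=> Bj; apply: contraTF Bj => /eqP->; apply: AB.
have comm j l w : B j -> B l -> e i j (e i l w) = e i l (e i j w).
  by move=> Bj Bl; rewrite br !neq // !scale0r subr0 addr0.
(* E_{j0 j0} kills m, so the iterates of E_{i j0} have weights 0, -1, -2... *)
have [k nil] : exists k, iter k (e i j0) m = 0.
  apply: (@shift_nilpotent _ _ (e j0 j0) _ (-1) 0) => [k|w||].
  - by rewrite mulrN1 oppr_eq0 pnatr_eq0.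
  - by rewrite br eqxx neq // scale0r addr0 scale1r scaleN1r.
  - by rewrite m0 ?scale0r.
  - exact: fin.
have foldr_comm j s w : B j -> List.Forall (fun j => B j /\ (val j0 < val j)%N) s ->
    e j0 j (foldr (e i) w s) = foldr (e i) (e j0 j w) s.
  move=> Bj; elim=> //= l {}s [Bl j0l] _ <-.
  rewrite br neq // (_ : l == j0 = false) ?scale0r ?subr0 ?addr0 //.
  by apply: contraTF j0l => /eqP->; rewrite ltnn.
have raise j r : B j -> (val j0 < val j)%N ->
    e j0 j (iter r.+1 (e i j0) m) = - r.+1%:R *: e i j (iter r (e i j0) m).
  move=> Bj j0j; elim: r => [|r IH] /=; rewrite br neq // eqxx scale0r addr0 scale1r.
    by rewrite (m0 _ _ Bj0 Bj (leqnn _) (ltnW j0j)) linear0 add0r scaleNr scale1r.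
  rewrite /= in IH; rewrite IH linearZ /= comm // -[X in _ - X]scale1r -scalerBl.
  by rewrite -opprD natr1.
have foldrZ a w s : foldr (e i) (a *: w) s = a *: foldr (e i) w s.
  by elim: s => //= l s ->; rewrite linearZ.
exists k => s; have gen r : List.Forall (fun j => B j /\ (val j0 < val j)%N) s ->
    (r + size s)%N = k -> foldr (e i) (iter r (e i j0) m) s = 0.
  elim/last_ind: s r => [|s l IH] r; first by rewrite addn0 => _ ->.
  rewrite -cats1 => /List.Forall_app[Ps Pl]; have [Bl j0l] := List.Forall_inv Pl.
  rewrite size_cat addn1 addnS -addSn => rk.
  have := foldr_comm l s (iter r.+1 (e i j0) m) Bl Ps.
  rewrite IH // linear0 raise // foldrZ => /esym/eqP.
  by rewrite scaler_eq0 oppr_eq0 pnatr_eq0 /= foldr_cat => /eqP.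
by move=> Ps sk; apply: (gen 0%N).
Qed.

Lemma disjoint_neq A B k l : disjoint_preds A B -> A k -> B l ->
  ((l == k) = false) * ((k == l) = false).
Proof.
move=> AB Ak Bl; have lk : (l == k) = false.
  by apply: contraTF Bl => /eqP->; apply: AB.
by rewrite [k == l]eq_sym lk.
Qed.

Definition block A B (i j : index) : Prop := A i /\ B j.

(** Distinctness of row and column indices makes the block an abelian
    subalgebra. *)
Lemma block_commute e A B i j k l w :
  tame_gl_action e -> disjoint_preds A B -> A i -> B j -> A k -> B l ->
  e i j (e k l w) = e k l (e i j w).
Proof.
move=> he AB Ai Bj Ak Bl; rewrite (gl_bracket he).
by rewrite (disjoint_neq AB Ak Bj) (disjoint_neq AB Ai Bl) !scale0r subr0 addr0.
Qed.

Lemma row_tail_vanishing e A B i S m :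
  tame_gl_action e -> disjoint_preds A B -> unbounded B -> A i ->
  stable e (block A B) S -> S m -> m <> 0 ->
  exists v, [/\ S v, v <> 0 &
    exists N, forall j, B j -> (N <= val j)%N -> e i j v = 0].
Proof.
move=> he AB unbB Ai stS Sm m0; have [n nP] := gl_tail he m.
have [j0 [Bj0 nj0]] := unbB n.
have [|k kP] := row_products_nilpotent (m := m) he AB Ai Bj0.
  by move=> a b _ _ /(leq_trans nj0) na /(leq_trans nj0) nb; apply: nP.
have [|v [Sv v0 vP]] := last_nonzero_product (S := S) _ Sm m0 kP.
  by move=> j w [Bj _]; apply: stS.
by exists v; split => //; exists (val j0).+1 => j Bj j0j; apply: vP.
Qed.

(** Only the rows i < n have to be treated, n being a bound beyond which m is
    killed; a row once treated remains so because the block is abelian.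
    Finitely many rows give the uniform bound N. *)
Lemma row_tails_vanishing e A B S m :
  tame_gl_action e -> disjoint_preds A B -> unbounded B ->
  stable e (block A B) S -> S m -> m <> 0 ->
  exists v, [/\ S v, v <> 0 &
    exists N, forall i j, A i -> B j -> (N <= val j)%N -> e i j v = 0].
Proof.
move=> he AB unbB stS Sm m0; have [n nP] := gl_tail he m.
pose Z k N := [set w | S w /\ forall i j : index, A i -> B j ->
  (val i < k)%N || (n <= val i)%N -> (N <= val j)%N -> e i j w = 0].
suff [v [v0 [N [Sv vP]]]] : exists v, v <> 0 /\ exists N, Z n N v.
  exists v; split=> //; exists N => i j Ai Bj Nj.
  by apply: vP => //; case: ltnP.
elim: {1}n => [|k [v [v0 [N [Sv vP]]]]].
  by exists m; split=> //; exists n; split=> // i j _ _ /= ni nj; apply: nP.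
have [[i [Ai ik]]|noi] := pselect (exists i : index, A i /\ val i = k); last first.
  exists v; split=> //; exists N; split=> // i j Ai Bj; rewrite ltnS leq_eqVlt.
  by case: eqP => [ik|_] /=; [case: noi; exists i|apply: vP].
have [||w [[Sw wP] w0 [N' wN']]] :=
  row_tail_vanishing (S := Z k N) (m := v) he AB unbB Ai _ _ v0.
- move=> a b w [Aa Bb] [Sw wP]; split; first by apply: stS.
  by move=> i' j Ai' Bj h Nj; rewrite (block_commute _ he AB) // wP // linear0.
- by [].
exists w; split=> //; exists (maxn N N'); split=> // i' j Ai' Bj.
rewrite geq_max ltnS leq_eqVlt -orbA => /orP[/eqP i'k|h] /andP[Nj N'j];
  last exact: wP.
by rewrite (_ : i' = i) ?wN' //; apply: val_inj; rewrite i'k.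
Qed.

(** With rows and columns treated, E_ij v = 0 when i or j is large.  For k and l
    large, E_ik = [E_il, E_lk] and E_ij = [E_ik, E_kj] reduce all other entries
    of the block to these. *)
Lemma block_vanishing e A B S m :
  tame_gl_action e -> disjoint_preds A B -> unbounded A -> unbounded B ->
  is_subspace S -> stable e (block A B) S -> S m -> m <> 0 ->
  exists v, [/\ S v, v <> 0 & forall i j, A i -> B j -> e i j v = 0].
Proof.
move=> he AB unbA unbB subS stS Sm m0.
have [u [Su u0 [N uN]]] := row_tails_vanishing he AB unbB stS Sm m0.
pose Z := [set w | S w /\
  forall i j : index, A i -> B j -> (N <= val j)%N -> e i j w = 0].
have BA : disjoint_preds B A by move=> k; apply: contraL; apply: AB.
have [||v [[Sv vN] v0 [N' vN']]] :=
  row_tails_vanishing (S := Z) (m := u) (tame_gl_dual he) BA unbA _ _ u0.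
- move=> j i w [Bj Ai] [Sw wN]; split=> [|k l Ak Bl Nl] /=.
    by rewrite -scaleN1r; apply: subspaceZ => //; apply: stS.
  by rewrite linearN (block_commute _ he AB) // wN // linear0 oppr0.
- by [].
exists v; split=> // i j Ai Bj; have [n nP] := gl_tail he v.
pose p := maxn N (maxn N' n).
have [l [Bl]] := unbB p; rewrite !geq_max => /and3P[Nl _ nl].
have [k [Ak]] := unbA (maxn p (val i).+1).
rewrite !geq_max -!andbA => /and4P[_ N'k nk ik].
have kj : e k j v = 0 by have /eqP := vN' j k Bj Ak N'k; rewrite oppr_eq0 => /eqP.
have il : e i l v = 0 by apply: vN.
have ki : (k == i) = false by apply: contraTF ik => /eqP->; rewrite ltnn.
have ik0 : e i k v = 0.
  have := gl_bracket he i l l k v; rewrite nP // il !linear0 eqxx ki scale0r.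
  by rewrite subr0 add0r scale1r => <-.
have := gl_bracket he i k k j v; rewrite kj ik0 !linear0 eqxx.
by rewrite (disjoint_neq AB Ai Bj) scale0r subr0 add0r scale1r => <-.
Qed.

End Blocks.

(** * The order on roots *)

Definition odd_index : pred index := fun i => odd (val i).
Definition even_index : pred index := fun i => ~~ odd (val i).

Lemma odd_unbounded : unbounded odd_index.
Proof.
move=> n; exists (exist _ n.*2.+1 (ltn0Sn _)); split.
  by rewrite /odd_index /= odd_double.
by rewrite /= -addnn; lia.
Qed.

Lemma even_unbounded : unbounded even_index.
Proof.
move=> n; exists (exist _ n.*2.+2 (ltn0Sn _)); split.
  by rewrite /even_index /= odd_double.
by rewrite /= -addnn; lia.
Qed.

Lemma odd_even_disjoint : disjoint_preds odd_index even_index.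
Proof. by move=> i; rewrite /even_index negbK. Qed.

Lemma prec_trans i j k : prec i j -> prec j k -> prec i k.
Proof.
rewrite /prec; case: (odd (val i)); case: (odd (val j)); case: (odd (val k)) => //=;
  lia.
Qed.

Lemma prec_irrefl i : prec i i = false.
Proof. by rewrite /prec ltnn; case: odd. Qed.

Section RootOrder.
Variable n : nat.

(** For indices below n, the rank in the order 1, 3, 5, ..., 6, 4, 2. *)
Definition position (i : index) : nat :=
  if odd (val i) then val i else (n.*2 - val i)%N.

(** A linear order on the matrix positions with both indices below n: columns
    from the largest to the smallest, and inside a column rows from the smallest.
    Commuting a root vector of position (i, j) with another one gives root
    vectors with the same j and an earlier i, or the same i and a later j:
    these have a smaller key. *)
Definition root_key (i j : index) : nat :=
  ((n.*2 - position j) * n.*2 + position i)%N.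

Lemma position_bound i : (val i < n)%N -> (position i < n.*2)%N.
Proof.
move=> i_n; have i0 := valP i; rewrite /position -addnn.
by case: ifP => _; lia.
Qed.

Lemma position_prec i j : (val i < n)%N -> (val j < n)%N -> prec i j ->
  (position i < position j)%N.
Proof.
rewrite /prec /position -addnn; move: (val i) (val j) => x y.
by case: (odd x); case: (odd y) => /=; lia.
Qed.

Lemma position_inj i j : (val i < n)%N -> (val j < n)%N ->
  position i = position j -> i = j.
Proof.
move=> i_n j_n; rewrite /position -addnn => h; apply: val_inj; move: h.
rewrite -!/(val _); move: i_n j_n; move: (val i) (val j) => x y.
by case: (odd x); case: (odd y); lia.
Qed.

Lemma root_key_inj i j k l : (val i < n)%N -> (val j < n)%N ->
  (val k < n)%N -> (val l < n)%N -> root_key i j = root_key k l ->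
  i = k /\ j = l.
Proof.
move=> i_n j_n k_n l_n; rewrite /root_key => h.
have [pi pj pk pl] := And4 (position_bound i_n) (position_bound j_n)
  (position_bound k_n) (position_bound l_n).
have n0 : (0 < n.*2)%N by apply: leq_trans pi.
have hi : position i = position k.
  by move/(congr1 (modn^~ n.*2)): h; rewrite !modnMDl !modn_small.
split; first exact: position_inj.
move/(congr1 (divn^~ n.*2)): h; rewrite !divnMDl // !divn_small // !addn0 => h.
by apply: position_inj => //; lia.
Qed.

Lemma root_key_extendl i a b : (val i < n)%N -> (val a < n)%N ->
  prec i a -> (root_key i b < root_key a b)%N.
Proof. by move=> i_n a_n ia; rewrite /root_key ltn_add2l position_prec. Qed.

Lemma root_key_extendr a b j : (val a < n)%N -> (val b < n)%N -> (val j < n)%N ->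
  prec b j -> (root_key a j < root_key a b)%N.
Proof.
move=> a_n b_n j_n bj; have := position_prec b_n j_n bj.
have := position_bound j_n; have := position_bound b_n => pb pj bj'.
rewrite /root_key ltn_add2r ltn_mul2r; apply/andP; split; lia.
Qed.

Lemma root_key_bound i j : (val i < n)%N -> (val j < n)%N ->
  (root_key i j < n.*2 * n.*2 + n.*2)%N.
Proof.
move=> i_n j_n; rewrite /root_key -addnS; apply: leq_add.
  by rewrite leq_mul2r leq_subr orbT.
exact: position_bound.
Qed.

End RootOrder.

(** * Highest weight vectors over gl(oo) *)

Definition weight_vectors (K : fieldType) (M : lmodType K)
    (e : index -> index -> {linear M -> M}) : set M :=
  [set v | forall k, exists c, e k k v = c *: v].

Section HighestWeight.
Variables (K : numClosedFieldType) (M : lmodType K).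
Implicit Types (e : index -> index -> {linear M -> M}) (S : set M) (m v w : M).
Implicit Types (A B : pred index).

(** E_ij = [E_ik, E_kj] with k a distant index satisfying B, up to the term E_kk
    when i = j, which kills v as well. *)
Lemma block_tail_vanishing e A B n v :
  tame_gl_action e -> disjoint_preds A B -> unbounded B ->
  (forall i j : index, (n <= val i)%N -> (n <= val j)%N -> e i j v = 0) ->
  (forall i j, A i -> B j -> e i j v = 0) ->
  forall i j, A i -> A j -> (n <= val j)%N -> e i j v = 0.
Proof.
move=> he AB unbB nP blk i j Ai Aj nj.
have [k [Bk nk]] := unbB n.
have := gl_bracket he i k k j v.
rewrite (nP k j) // (blk i k) // !linear0 eqxx add0r scale1r (nP k k) //.
by rewrite scaler0 subr0 => <-.
Qed.

(** A positive root with an index beyond n either lies in the block, or has both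
    indices odd and the second one large, or both even and the first one large;
    the last case is the dual of the preceding one. *)
Lemma prec_tail_vanishing e v : tame_gl_action e ->
  (forall i j, odd_index i -> even_index j -> e i j v = 0) ->
  exists n, forall i j, prec i j -> (n <= val i)%N || (n <= val j)%N ->
    e i j v = 0.
Proof.
move=> he blk; have [n nP] := gl_tail he v; exists n => i j ij nij.
have [oi|ei] := boolP (odd_index i); have [oj|ej] := boolP (odd_index j).
- apply: (block_tail_vanishing he odd_even_disjoint even_unbounded nP blk) => //.
  move: ij; rewrite /prec [odd (val i)]oi [odd (val j)]oj /= => /ltnW ij.
  by case/orP: nij => // ni; apply: leq_trans ij.
- exact: blk.
- by move: ij ei oj; rewrite /prec /odd_index => + /negPf ei oj; rewrite ei oj.
have ed : disjoint_preds even_index odd_index by [].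
have ni : (n <= val i)%N.
  have /ltnW ji : (val j < val i)%N.
    by move: ij ei ej; rewrite /prec /odd_index => + /negPf ei ej; rewrite ei ej.
  by case/orP: nij => // nj; apply: leq_trans ji.
apply: oppr_inj; rewrite oppr0.
apply: (block_tail_vanishing (v := v) (n := n) (tame_gl_dual he) ed
  odd_unbounded _ _ ej ei ni).
- by move=> k l nk nl /=; rewrite nP ?oppr0.
- by move=> k l ek ol /=; rewrite blk ?oppr0.
Qed.

(** Common eigenvectors are constructed for one diagonal unit after the other;
    the units beyond n act by zero, and eigenvectors stay eigenvectors since
    diagonal units commute. *)
Lemma weight_vector_exists e S m : tame_gl_action e ->
  (forall k a w, S w -> S (e k k w - a *: w)) -> S m -> m <> 0 ->
  exists v, [/\ S v, v <> 0 & weight_vectors e v].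
Proof.
move=> he stS Sm m0; have [n nP] := gl_tail he m.
pose Z k := [set w | S w /\ forall i : index,
  (val i < k)%N || (n <= val i)%N -> exists c, e i i w = c *: w].
suff [v [v0 [Sv vP]]] : exists v, v <> 0 /\ Z n v.
  by exists v; split=> // i; apply: vP; case: ltnP.
elim: {1}n => [|k [v [v0 [Sv vP]]]].
  exists m; split=> //; split=> // i /= ni.
  by exists 0; rewrite nP ?scale0r.
have [[i ik]|noi] := pselect (exists i : index, val i = k); last first.
  exists v; split=> //; split=> // i; rewrite ltnS leq_eqVlt.
  by case: eqP => [ik|_] /=; [case: noi; exists i|apply: vP].
have [|w [[Sw wP] w0 wi]] :=
  eigenvector_exists (f := e i i) (S := Z k) _ (conj Sv vP) v0
    (gl_locally_finite he i i v).
  move=> a w [Sw wP]; split=> [|l h]; first exact: stS.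
  have [c cP] := wP l h; exists c.
  have comm : e l l (e i i w) = e i i (e l l w).
    rewrite (gl_bracket he); case: (eqVneq l i) => [->|_].
      by rewrite addrK.
    by rewrite !scale0r subr0 addr0.
  by rewrite linearB linearZ /= comm cP linearZ /= scalerBr !scalerA mulrC.
exists w; split=> //; split=> // j; rewrite ltnS leq_eqVlt -orbA => /orP[/eqP jk|];
  last exact: wP.
by rewrite (_ : j = i) //; apply: val_inj; rewrite jk.
Qed.

Lemma weight_root e a b w : tame_gl_action e ->
  weight_vectors e w -> weight_vectors e (e a b w).
Proof.
move=> he wt k; have [c cP] := wt k.
exists (c + (k == a)%:R - (b == k)%:R).
rewrite (gl_bracket he) cP linearZ /= scalerBl scalerDl.
by congr (_ + _ - _); case: eqP => [->|_]; rewrite ?scale0r.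
Qed.

(** The iterates of E_ab have distinct eigenvalues for E_aa. *)
Lemma root_nilpotent e a b w : tame_gl_action e -> a != b ->
  weight_vectors e w -> exists k, iter k (e a b) w = 0.
Proof.
move=> he ab wt; have [c cP] := wt a.
apply: (@shift_nilpotent _ _ (e a a) _ 1 c) => [k|u||] //.
- by rewrite mulr1 pnatr_eq0.
- by rewrite (gl_bracket he) eqxx eq_sym (negPf ab) scale0r subr0.
exact: (gl_locally_finite he).
Qed.

(** After [block_vanishing] and [prec_tail_vanishing] the roots with an index
    beyond n are dealt with.  The others are treated by increasing key: the
    roots already treated together with the far ones form an ideal of the
    nilradical, so applying E_ab keeps the vanishing obtained so far. *)
Lemma highest_weight_vector_exists e S m : tame_gl_action e ->
  is_subspace S -> (forall i j w, S w -> S (e i j w)) -> S m -> m <> 0 ->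
  exists v, [/\ S v, v <> 0, weight_vectors e v
    & forall i j, prec i j -> e i j v = 0].
Proof.
move=> he subS stS Sm m0.
have [|v1 [Sv1 v10 blk]] := block_vanishing (e := e) he odd_even_disjoint
  odd_unbounded even_unbounded subS _ Sm m0.
  by move=> i j w _; apply: stS.
have [n nP] := prec_tail_vanishing he blk.
pose far (i j : index) := (n <= val i)%N || (n <= val j)%N.
pose S1 := [set w | S w /\ forall i j, prec i j -> far i j -> e i j w = 0].
have [||v2 [[Sv2 far2] v20 wt2]] :=
  weight_vector_exists (S := S1) (m := v1) he _ _ v10.
- move=> k a w [Sw wP]; split=> [|i j ij fij].
    rewrite -scaleNr addrC; case: subS => _; apply => //; exact: stS.
  rewrite linearB linearZ /= (gl_bracket he) wP // linear0 scaler0 subr0 add0r.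
  have -> : (j == k)%:R *: e i k w = 0.
    by case: eqP => [<-|_]; [rewrite wP ?scaler0|rewrite scale0r].
  by case: eqP => [->|_]; [rewrite wP ?scaler0 ?subr0|rewrite scale0r subr0].
- by [].
pose Z t := [set w | [/\ S w, weight_vectors e w & forall i j, prec i j ->
  far i j || (root_key n i j < t)%N -> e i j w = 0]].
suff [v [v0 [Sv vt vP]]] : exists v, v <> 0 /\ Z (n.*2 * n.*2 + n.*2)%N v.
  exists v; split => // i j ij; apply: vP => //; have [//|] := boolP (far i j).
  by rewrite negb_or -!ltnNge => /andP[i_n j_n]; apply: root_key_bound.
elim: (n.*2 * n.*2 + n.*2)%N => [|t [v [v0 [Sv wtv vP]]]].
  by exists v2; split=> //; split=> // i j ij; rewrite orbF; apply: far2.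
have [[a [b [ab a_n b_n abt]]]|noab] := pselect (exists a b,
    [/\ prec a b, (val a < n)%N, (val b < n)%N & root_key n a b = t]); last first.
  exists v; split=> //; split=> // i j ij; rewrite ltnS leq_eqVlt.
  case: eqP => [ijt|_]; last exact: vP.
  have [fij|] := boolP (far i j); first by move=> _; apply: vP; rewrite ?fij.
  rewrite negb_or -!ltnNge => /andP[i_n j_n]; case: noab; exists i, j; split=> //.
have aNb : a != b by apply: contraTneq ab => ->; rewrite prec_irrefl.
have [k nil] := root_nilpotent he aNb wtv.
have [|||w [[Sw wtw wP] w0 wab]] := last_nonzero_product
  (P := fun _ : unit => True) (x := fun _ => e a b) (S := Z t)
  (k := k) (m := v) _ _ v0.
- move=> _ w _ [Sw wtw wP]; split; [exact: stS|exact: weight_root|].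
  move=> i j ij h; rewrite (gl_bracket he) wP // linear0 add0r.
  (* E_ij is already treated; its two possible commutators with E_ab are E_ib,
     of smaller key than E_ab when i is below n, and E_aj, likewise for j. *)
  have -> : (j == a)%:R *: e i b w = 0.
    case: eqP => [ja|_]; last by rewrite scale0r.
    rewrite wP ?scaler0 //; first by rewrite ja in ij; apply: prec_trans ij ab.
    rewrite /far; case: (leqP n (val i)) => //= i_n.
    by rewrite -abt root_key_extendl ?orbT // -?ja.
  have -> : (b == i)%:R *: e a j w = 0; last by rewrite subr0.
  case: eqP => [bi|_]; last by rewrite scale0r.
  rewrite wP ?scaler0 //; first by rewrite -bi in ij; apply: prec_trans ab ij.
  rewrite /far; case: (leqP n (val j)) => //= j_n; rewrite ?orbT //.
  by rewrite -abt root_key_extendr ?orbT // bi.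
- by [].
- by move=> s _ sk; rewrite -[RHS]nil -sk; elim: s {sk} => //= _ s ->.
exists w; split=> //; split=> // i j ij; rewrite ltnS leq_eqVlt.
case: eqP => [ijt|_]; last exact: wP.
have [fij|] := boolP (far i j); first by move=> _; apply: wP; rewrite ?fij.
rewrite negb_or -!ltnNge => /andP[i_n j_n] _.
have [-> ->] : i = a /\ j = b by apply: (root_key_inj i_n); rewrite // abt.
exact: wab.
Qed.

End HighestWeight.

(** * Brackets in W(oo) *)

Section WinftyRelations.
Variable K : fieldType.

(** What spans is known among all operators on the Grassmann algebra; the
    induction hypothesis quantifies over the elements of W(oo) with a given
    underlying operator to bring it back to W(oo). *)
Lemma Winfty_monomial_ind (P : set (Winfty K)) : is_subspace P ->
  (forall A j, P (vect (gmonomial K A) j)) -> forall x, P x.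
Proof.
move=> subP Pmono x.
suff [_] : [set D | op_W D /\ forall y : Winfty K, Wop y = D -> P y] (Wop x).
  exact.
have Wx := op_W_Wop x; move: (Wop x) (op_W_monomial Wx).
apply: span_min => [|_ [A [j ->]]].
  split=> [|a D E [WD PD] [WE PE]] /=.
    split; first by case: (subspace_span [set D | exists P j, D = @op_vect K P j]).
    by move=> y y0; rewrite (_ : y = 0); [case: subP|apply: val_inj].
  split.
    by case: (subspace_span [set D | exists P j, D = @op_vect K P j]) => _; apply.
  move=> y yE; rewrite (_ : y = a *: to_Winfty WD + to_Winfty WE).
    by case: subP => _; apply; [apply: PD|apply: PE].
  exact: val_inj.
split=> [|y yE]; first exact: op_W_vect.
by rewrite (_ : y = vect (gmonomial K A) j) //; apply: val_inj.
Qed.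

Lemma vectZ (a : K) P j : vect (a *: P) j = a *: vect P j.
Proof.
by apply: val_inj; apply/funext => Q; rewrite /= {1}/op_vect -scalerAl.
Qed.

Lemma Wdeg_monomial A j : Wdeg (#|` A|%:Z - 1) (vect (gmonomial K A) j).
Proof.
move=> S [_]; apply; exists (gmonomial K A), j; split=> // B.
by rewrite /gmonomial msuppU oner_eq0 in_fset1 subrK => /eqP->.
Qed.

Lemma Wparity_Wdeg k (x : Winfty K) : Wdeg k x -> Wparity (odd `|k|%N) x.
Proof. by move=> kx S [_]; apply; exists k. Qed.

Lemma Wdeg0 k : Wdeg k (0 : Winfty K).
Proof. exact: (subspace_span _).1. Qed.

Lemma Wdeg_partial j : Wdeg (-1) (partial K j).
Proof. by have := @Wdeg_monomial fset0 j; rewrite cardfs0. Qed.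

Lemma Wdeg_Eunit i j : Wdeg 0 (Eunit K i j).
Proof. by have := @Wdeg_monomial [fset i]%fset j; rewrite cardfs1. Qed.

Lemma Wparity_partial j : Wparity true (partial K j).
Proof. exact: (Wparity_Wdeg (@Wdeg_partial j)). Qed.

Lemma Wparity_Eunit i j : Wparity false (Eunit K i j).
Proof. exact: (Wparity_Wdeg (@Wdeg_Eunit i j)). Qed.

Lemma Wneg_partial_span :
  @Wneg K `<=` span [set x | exists j, x = partial K j].
Proof.
apply: span_min; first exact: subspace_span.
move=> _ [P [j [hP ->]]].
have -> : P = P@_fset0 *: 1.
  apply/malgP => A; rewrite mcoeffZ.
  have [->|A0] := eqVneq A fset0; first by rewrite mcoeffUU mulr1.
  rewrite mcoeffU eq_sym (negPf A0) mulr0 mcoeff_outdom //.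
  apply: contra A0 => /hP; rewrite addNr => /eqP.
  by rewrite -cardfs_eq0.
rewrite vectZ.
apply: (@subspaceZ _ _ (span _) _ _ (subspace_span _)).
by move=> S [_]; apply; exists j.
Qed.

#[local] Opaque gmonomial.

Lemma vect_mul_deriv_xi (P : grassmann K) i k j :
  vect (P * gderiv i (xi K k)) j = (i == k)%:R *: vect P j.
Proof.
rewrite gderiv_xi; case: (i == k); first by rewrite mulr1 scale1r.
by rewrite mulr0 -(scale0r P) vectZ.
Qed.

Lemma partialE j : partial K j = vect (gmonomial K fset0) j.
Proof. by []. Qed.

Lemma vect_mul_deriv_one (P : grassmann K) i j :
  vect (P * gderiv i (gmonomial K fset0)) j = 0.
Proof.
rewrite gderivE /gderiv_monomial in_fset0.
by rewrite mulr0 -(scale0r P) vectZ scale0r.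
Qed.

Lemma bracket_monomial A B i j :
  bracket (vect (gmonomial K A) i) (vect (gmonomial K B) j) =
  vect (gmonomial K A * gderiv i (gmonomial K B)) j
  - (-1) ^+ (~~ odd #|` A| && ~~ odd #|` B|) *:
    vect (gmonomial K B * gderiv j (gmonomial K A)) i.
Proof. apply: val_inj; exact: op_bracket_vect. Qed.

Lemma bracket_Eunit i j k l : bracket (Eunit K i j) (Eunit K k l) =
  (j == k)%:R *: Eunit K i l - (l == i)%:R *: Eunit K k j.
Proof.
rewrite (@bracket_monomial [fset i]%fset [fset k]%fset) -!/(xi K _).
congr (_ - _); first exact: vect_mul_deriv_xi.
by rewrite vect_mul_deriv_xi !cardfs1 expr0 scale1r.
Qed.

Lemma bracket_partial i j : bracket (partial K i) (partial K j) = 0.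
Proof.
rewrite !partialE bracket_monomial -[RHS](subr0 0); congr (_ - _).
  exact: vect_mul_deriv_one.
by rewrite vect_mul_deriv_one scaler0.
Qed.

Lemma bracket_partial_Eunit i k l :
  bracket (partial K i) (Eunit K k l) = (i == k)%:R *: partial K l.
Proof.
rewrite !partialE bracket_monomial -!/(xi K _) -[RHS]subr0; congr (_ - _).
  exact: vect_mul_deriv_xi.
by rewrite vect_mul_deriv_one scaler0.
Qed.

End WinftyRelations.

(** * Singular vectors of modules over W(oo) *)

Section Supermodules.
Variables (K : numFieldType) (M : lmodType K) (rho : supermodule M).
Implicit Types (m v w : M).

Definition act_lin (x : Winfty K) : {linear M -> M} :=
  HB.pack (act rho x)
    (GRing.isLinear.Build K M M *:%R (act rho x) (act_linearr rho x)).

(** The identification of the degree zero part with gl(oo). *)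
Definition gl_act (i j : index) : {linear M -> M} := act_lin (Eunit K i j).

Lemma actDl x y m : act rho (x + y) m = act rho x m + act rho y m.
Proof. by have := act_linearl rho m 1 x y; rewrite !scale1r. Qed.

Lemma act0l m : act rho 0 m = 0.
Proof.
by have := act_linearl rho m (-1) 0 0; rewrite scaler0 addr0 scaleN1r addNr.
Qed.

Lemma actZl a x m : act rho (a *: x) m = a *: act rho x m.
Proof. by have := act_linearl rho m a x 0; rewrite !addr0 act0l addr0. Qed.

Lemma actNl x m : act rho (- x) m = - act rho x m.
Proof. by rewrite -(scaleN1r x) actZl scaleN1r. Qed.

Lemma act0r x : act rho x 0 = 0.
Proof. exact: (linear0 (act_lin x)). Qed.

Lemma actDr x m w : act rho x (m + w) = act rho x m + act rho x w.
Proof. exact: (linearD (act_lin x)). Qed.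

Lemma act_commute p q x y m : Wparity p x -> Wparity q y ->
  act rho x (act rho y m) =
    act rho (bracket x y) m + (-1) ^+ (p && q) *: act rho y (act rho x m).
Proof. by move=> px qy; rewrite (act_bracket rho m px qy) subrK. Qed.

Lemma parity_subspace q : is_subspace (mparity rho q).
Proof. by case: (mparity_grading rho). Qed.

Lemma parity_components m0 m1 w0 w1 :
  mparity rho false m0 -> mparity rho true m1 ->
  mparity rho false w0 -> mparity rho true w1 ->
  m0 + m1 = w0 + w1 -> m0 = w0 /\ m1 = w1.
Proof.
move=> hm0 hm1 hw0 hw1 e; have [_ _ ind] := mparity_grading rho.
have subB q u v : mparity rho q u -> mparity rho q v -> mparity rho q (u - v).
  move=> hu hv; rewrite addrC -scaleN1r.
  by case: (parity_subspace q) => _; apply.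
pose c p := if p then m1 - w1 else m0 - w0.
have c0 : forall p, p \in [:: false; true] -> c p = 0.
  apply: ind => // [[]|]; [exact: subB|exact: subB|].
  by rewrite big_cons big_seq1 /c addrACA -opprD e subrr.
split; apply/eqP; rewrite -subr_eq0; apply/eqP; first exact: (c0 false).
exact: (c0 true).
Qed.

Lemma homogeneous_nonzero m : m <> 0 ->
  exists q w, w <> 0 /\ mparity rho q w.
Proof.
move=> m0; have [_ /(_ m)[s [c [cP mE]]] _] := mparity_grading rho.
apply: contrapT => no; apply: m0; rewrite mE big1 // => q _.
by apply: contrapT => cq; apply: no; exists q, (c q).
Qed.

(** Homogeneous vectors killed by all of g^<; homogeneity will make the generated
    submodule graded. *)
Definition singular q : set M :=
  [set m | mparity rho q m /\ forall k, act rho (partial K k) m = 0].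

Lemma singular_subspace q : is_subspace (singular q).
Proof.
split=> [|a u v [pu du] [pv dv]].
  by split=> [|k]; [case: (parity_subspace q)|rewrite act0r].
split=> [|k]; first by case: (parity_subspace q) => _; apply.
by rewrite (act_linearr rho) du dv scaler0 addr0.
Qed.

(** g^0 is even and normalizes g^<. *)
Lemma singular_stable q i j w : singular q w -> singular q (gl_act i j w).
Proof.
move=> [pw dw]; split=> [|k] /=.
  exact: (act_parity (Wparity_Eunit i j) pw).
rewrite (act_commute w (Wparity_partial k) (Wparity_Eunit i j)) dw act0r.
by rewrite bracket_partial_Eunit actZl dw !scaler0 addr0.
Qed.

Hypothesis ann :
  locally_annihilated rho (fun n => @tail_algebra K n `&` @Wle K).

Lemma tail_partial m :
  exists n, forall k : index, (n <= val k)%N -> act rho (partial K k) m = 0.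
Proof.
have [n nP] := ann m; exists (val n) => k nk; apply: nP; split.
  by move=> S [_ GS]; apply: GS; left; exists k.
exists (partial K k); first exact: Wdeg_partial.
by exists 0; rewrite ?addr0 //; apply: Wdeg0.
Qed.

Lemma tail_Eunit m : exists n, forall i j : index,
  (n <= val i)%N -> (n <= val j)%N -> gl_act i j m = 0.
Proof.
have [n nP] := ann m; exists (val n) => i j ni nj; apply: nP; split.
  move=> S [_ GS]; apply: GS; right; exists [:: i], j.
  by rewrite big_seq1 /= ni.
exists 0; last by exists (Eunit K i j); rewrite ?add0r //; exact: Wdeg_Eunit.
exact: Wdeg0.
Qed.

(** Only the derivatives by the first n variables can act nontrivially on w.
    Applying one of them, when the result is nonzero, gives a vector killed by
    it, and by anticommutation keeps the vanishing of the others. *)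
Lemma singular_vector_exists m : m <> 0 ->
  exists q v, v <> 0 /\ singular q v.
Proof.
move=> /homogeneous_nonzero[q0 [w [w0 pw]]]; have [n nP] := tail_partial w.
pose Z k q := [set v | mparity rho q v /\ forall l : index,
  (val l < k)%N || (n <= val l)%N -> act rho (partial K l) v = 0].
suff [q [v [v0 [pv vP]]]] : exists q v, v <> 0 /\ Z n q v.
  by exists q, v; split=> //; split=> // k; apply: vP; case: ltnP.
elim: {1}n => [|k [q [v [v0 [pv vP]]]]].
  by exists q0, w; split=> //; split=> // l /= nl; apply: nP.
have [[a [ak av0]]|noa] := pselect (exists a : index,
    val a = k /\ act rho (partial K a) v <> 0); last first.
  exists q, v; split=> //; split=> // l; rewrite ltnS leq_eqVlt.
  case: eqP => [lk _|_]; last exact: vP.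
  by apply: contrapT => lv; apply: noa; exists l.
have anti l : act rho (partial K l) (act rho (partial K a) v) =
    - act rho (partial K a) (act rho (partial K l) v).
  rewrite (act_commute v (Wparity_partial l) (Wparity_partial a)).
  by rewrite bracket_partial act0l add0r expr1 scaleN1r.
exists (~~ q), (act rho (partial K a) v); split=> //; split=> [|l].
  exact: (act_parity (Wparity_partial a) pv).
rewrite ltnS leq_eqVlt -orbA => /orP[/eqP lk|h];
  last by rewrite anti vP // act0r oppr0.
have -> : l = a by apply: val_inj; rewrite lk.
move/eqP: (anti a); rewrite -subr_eq0 opprK -mulr2n -scaler_nat scaler_eq0.
by rewrite pnatr_eq0 => /eqP.
Qed.

Hypothesis integ : integrable rho.

Lemma gl_act_tame : tame_gl_action gl_act.
Proof.
split; last exact: tail_Eunit.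
  move=> i j k l m /=.
  rewrite (act_commute m (Wparity_Eunit i j) (Wparity_Eunit k l)).
  rewrite bracket_Eunit actDl actNl !actZl expr0 scale1r.
  by rewrite addrC addrA.
by move=> i j m; apply: integ; apply: Wdeg_Eunit.
Qed.

End Supermodules.

(** * Generation by a highest weight vector *)

Section Generation.
Variables (K : numFieldType) (M : lmodType K) (rho : supermodule M).

(** The sums of two homogeneous vectors of S form a submodule, because W(oo) is
    spanned by homogeneous elements; it contains v, hence S. *)
Lemma generated_submodule_graded q v : mparity rho q v ->
  is_graded_submodule rho (smallest (is_submodule rho) [set v]).
Proof.
move=> pv; set S := smallest _ _.
have subS : is_subspace S.
  split=> [T [[[]]]//|a u w Su Sw T hT].
  by case: (hT) => -[[_ TD] _] _; apply: TD; [apply: Su|apply: Sw].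
have actS x m : S m -> S (act rho x m).
  by move=> Sm T hT; case: (hT) => -[_ Tx] _; apply: Tx; apply: Sm.
pose T := [set m | exists m0 m1, [/\ mparity rho false m0, mparity rho true m1,
  S m0, S m1 & m = m0 + m1]].
have subT : is_subspace T.
  split.
    have [S0 _] := subS; exists 0, 0.
    split; rewrite ?addr0 //; [exact: (parity_subspace rho false).1|].
    exact: (parity_subspace rho true).1.
  move=> a _ _ [m0 [m1 [p0 p1 S0 S1 ->]]] [w0 [w1 [r0 r1 R0 R1 ->]]].
  exists (a *: m0 + w0), (a *: m1 + w1); split.
  - exact: (parity_subspace rho false).2.
  - exact: (parity_subspace rho true).2.
  - exact: subS.2.
  - exact: subS.2.
  - by rewrite scalerDr addrACA.
have hom p m : mparity rho p m -> S m -> T m.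
  have [[S0 _] [[P0 _] [P1 _]]] :=
    (subS, (parity_subspace rho false, parity_subspace rho true)).
  move=> pm Sm; case: p pm => pm; [exists 0, m|exists m, 0];
    by split; rewrite ?add0r ?addr0.
have ST : S `<=` T.
  apply: smallest_sub => [|_ ->]; last first.
    by apply: (hom q) => // U [_]; apply.
  split=> // x _ [m0 [m1 [p0 p1 S0 S1 ->]]].
  move: x; apply: Winfty_monomial_ind => [|A j].
    split=> [|a x y Tx Ty]; first by rewrite act0l; case: subT.
    by rewrite /= (act_linearl rho); case: subT => _; apply.
  have px := Wparity_Wdeg (@Wdeg_monomial K A j).
  rewrite actDr; apply: (subspaceD subT).
    by apply: hom (act_parity px p0) _; apply: actS.
  by apply: hom (act_parity px p1) _; apply: actS.
split=> // m0 m1 p0 p1 /ST[w0 [w1 [r0 r1 S0 S1 e]]].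
by have [-> ->] := parity_components p0 p1 r0 r1 e.
Qed.

Lemma cartan_weight_vector v : v <> 0 ->
  weight_vectors (gl_act rho) v -> weight_vector rho v.
Proof.
move=> v0 wt.
have ex h : exists c, cartan h -> act rho h v = c *: v.
  have [hh|nh] := pselect (cartan h); last by exists 0.
  suff [c cP] : [set h | exists c, act rho h v = c *: v] h by exists c.
  move: h hh; apply: span_min => [|_ [i ->]]; last exact: wt.
  split=> [|a x y [c cP] [d dP]] /=; first by exists 0; rewrite act0l scale0r.
  by exists (a * c + d); rewrite (act_linearl rho) cP dP scalerDl scalerA.
have [lambda lP] := choice ex; by exists lambda.
Qed.

Lemma nil_min_kills (r : rel index) v :
  (forall k, act rho (partial K k) v = 0) ->
  (forall i j, r i j -> gl_act rho i j v = 0) ->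
  forall x, nil_min r x -> act rho x v = 0.
Proof.
move=> dv ev _ [x nx [y ny <-]].
have subker : is_subspace [set x | act rho x v = 0].
  split=> [|a u w uv wv] /=; first exact: act0l.
  by rewrite (act_linearl rho) uv wv scaler0 addr0.
rewrite actDl; have -> : act rho x v = 0.
  move: x nx; apply: (span_min subker) => _ [i [j [ij ->]]]; exact: ev.
rewrite add0r; apply: (span_min subker _ (Wneg_partial_span ny)) => _ [j ->].
exact: dv.
Qed.

End Generation.

(** Algebraic closedness of the field provides weight vectors, characteristic
    zero the nilpotency of root vectors and its polarization. *)
Lemma simple_TW_le_highest_weight (K : numClosedFieldType) (M : lmodType K)
    (rho : supermodule M) :
  simple_module rho -> in_TW_le rho -> highest_weight_module rho prec.
Proof.
move=> [[m m0] simple] [_ integ ann].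
have [q [u [u0 su]]] := singular_vector_exists ann m0.
have [v [[pv dv] v0 wt hw]] := highest_weight_vector_exists (gl_act_tame ann integ)
  (singular_subspace rho q) (@singular_stable _ _ rho q) su u0.
exists v; split=> //; first exact: cartan_weight_vector.
  exact: nil_min_kills.
have [S0|//] := simple _ (generated_submodule_graded pv).
have : smallest (is_submodule rho) [set v] v by move=> S [_]; apply.
by rewrite S0.
Qed.

Theorem corollary5p10 (R : realType) (M : lmodType R[i]) (rho : supermodule M)
    (hsimple : simple_module rho) :
  (in_TW_le rho -> highest_weight_module rho prec) /\
  (in_TW rho -> highest_weight_module rho prec).
Proof.
have le_highest := simple_TW_le_highest_weight hsimple.
split=> // -[gr integ ann]; apply: le_highest; split=> // m.
by have [n nP] := ann m; exists n => x [tx _]; apply: nP.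
Qed.
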